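(* Let $\tilde P=(\mathbb Z,\preceq)$ be an affine poset of order $n$. Then the set $\bigcap_\tau h_\tau\subseteq \mathbb R^{\tilde P}/\mathcal C$, where the intersection runs over all proper tubes $\tau$ of $\tilde P$, is a realization of the affine poset cyclohedron $\mathscr C(\tilde P)$: it is a simple convex polytope of dimension $n-1$ whose face lattice is isomorphic to the set of proper tubings of $\tilde P$ ordered by reverse inclusion (vertices corresponding to maximal tubings).
   Context: An affine poset of order $n\ge1$ is a poset $\tilde P=(\mathbb Z,\preceq)$ such that (1) $i\preceq i+n$ for all $i$; (2) $i\preceq j\iff i+n\preceq j+n$ for all $i,j$; (3) for all $i,j\in\mathbb Z$ there is $k\in\mathbb Z$ with $i\preceq j+kn$. Write $i\lessdot j$ for a covering relation of $\tilde P$. A subset $\tau$ is connected if it induces a connected subgraph of the Hasse diagram, and convex if $a,c\in\tau$, $a\preceq b\preceq c$ imply $b\in\tau$. A tube is a connected convex subset $\tau$ with $|\tau|\ge2$ such that either $\tau=\tilde P$ or $\tau$ contains at most one element of each residue class mod $n$; a tube is proper if $\tau\ne\tilde P$. Two tubes are nested if one contains the other, disjoint if they do not intersect; for disjoint tubes $\sigma,\tau$ write $\sigma\prec\tau$ if there are $a\in\sigma,b\in\tau$ with $a\prec b$. A set $T$ of tubes is $n$-periodic if $\tau\in T$ implies $\tau+kn\in T$ for all $k\in\mathbb Z$. A proper tubing is an $n$-periodic set of proper tubes, pairwise nested or disjoint, such that whenever $\tau_1\prec\cdots\prec\tau_k$ in $T$ then $\tau_k\not\prec\tau_1$; it is maximal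 if maximal by inclusion. The affine poset cyclohedron $\mathscr C(\tilde P)$ is the (combinatorial type of) simple convex polytope of dimension $n-1$ whose face lattice is isomorphic to the set of proper tubings ordered by reverse inclusion. Let $c=n^{2(n+1)}$ and let $\mathbb R^{\tilde P}$ be the space of bi-infinite real sequences $(\tilde x_i)_{i\in\mathbb Z}$ with $\tilde x_{i+n}=\tilde x_i+c$ for all $i$; let $\mathbb R^{\tilde P}/\mathcal C$ denote this space modulo adding a constant to all entries. For finite $\tau\subseteq\mathbb Z$ define $\alpha_\tau(\tilde x)=\sum_{i\lessdot j,\ i,j\in\tau}(\tilde x_j-\tilde x_i)$ (well defined on the quotient), $h_\tau=\{p:\alpha_\tau(p)\ge n^{2|\tau|}\}$ and $H_\tau=\{p:\alpha_\tau(p)=n^{2|\tau|}\}$. *)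

(* Defs.v *)
From HB Require Import structures.
From Stdlib Require Import Relation_Operators.
From mathcomp Require Import all_boot all_order all_algebra finmap.
From mathcomp Require Import all_classical all_reals convex.

Set Implicit Arguments.
Unset Strict Implicit.
Unset Printing Implicit Defensive.

Import Order.TTheory GRing.Theory Num.Theory.

Local Open Scope classical_set_scope.
Local Open Scope ring_scope.
Local Open Scope quotient_scope.

(** * Convex polytopes in a (possibly infinite-dimensional) real vector space *)

Section Polytope.
Variables (R : realType) (V : lmodType R).
Implicit Types (A F Q : set V) (v : V).

Definition conv_hull A : set V := smallest (@convex_set R V) A.

Definition polytope Q : Prop :=
  exists A : set V, finite_set A /\ Q = conv_hull A.

Definition affinely_independent (m : nat) (p : 'I_m -> V) : Prop :=
  forall c : 'I_m -> R,
    \sum_i c i = 0 -> \sum_i c i *: p i = 0 -> forall i, c i = 0.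

(* [aff_dim A d]: a largest affinely independent family of points of [A] has
   [d + 1] members; this never holds for the empty set. *)
Definition aff_dim A (d : nat) : Prop :=
  (exists2 p : 'I_d.+1 -> V, (forall i, A (p i)) & affinely_independent p) /\
  (forall p : 'I_d.+2 -> V, (forall i, A (p i)) -> ~ affinely_independent p).

(* The empty face is excluded: the poset of proper tubings has a greatest
   element for reverse inclusion (the empty tubing, matching the polytope
   itself) but no element matching the empty face. *)
Definition face Q F : Prop :=
  F !=set0 /\
  exists (f : {scalar V}) (b : R),
    (forall x, Q x -> f x <= b) /\ F = Q `&` [set x | f x = b].

Definition vertex Q v : Prop := face Q [set v].

Definition facet Q F : Prop :=
  face Q F /\ exists d : nat, aff_dim Q d.+1 /\ aff_dim F d.

Definition simple_polytope Q (d : nat) : Prop :=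
  [/\ polytope Q, aff_dim Q d &
      forall v, vertex Q v -> ([set F | facet Q F /\ F v] #= `I_d)%card].

End Polytope.

(** * Affine posets, tubes and tubings *)

Record affinePoset (n : nat) := AffinePoset {
  ale : rel int;
  ale_refl : reflexive ale;
  ale_anti : antisymmetric ale;
  ale_trans : transitive ale;
  ale_addn : forall i, ale i (i + n%:Z);
  ale_shift : forall i j, ale i j = ale (i + n%:Z) (j + n%:Z);
  ale_cofinal : forall i j, exists k : int, ale i (j + k * n%:Z)
}.

Section Tubings.
Variables (n : nat) (P : affinePoset n).
Implicit Types (i j : int) (s t : set int) (T : set (set int)).

Definition alt i j : bool := (i != j) && ale P i j.

Definition covered i j : Prop :=
  alt i j /\ forall k, ~ (alt i k /\ alt k j).

Definition hasse i j : Prop := covered i j \/ covered j i.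

Definition hasse_connected t : Prop :=
  forall i j, t i -> t j ->
    clos_refl_trans int (fun a b => [/\ t a, t b & hasse a b]) i j.

Definition order_convex t : Prop :=
  forall a b c, t a -> t c -> ale P a b -> ale P b c -> t b.

Definition tube t : Prop :=
  [/\ hasse_connected t, order_convex t, (`I_2 #<= t)%card &
      t = setT \/ (forall i j, t i -> t j -> (i = j %[mod n])%Z -> i = j)].

Definition proper_tube t : Prop := tube t /\ t <> setT.

Definition nested s t : Prop := s `<=` t \/ t `<=` s.

Definition disjoint_tubes s t : Prop := s `&` t = set0.

Definition tube_lt s t : Prop :=
  disjoint_tubes s t /\ exists a b, [/\ s a, t b & alt a b].

Definition shift_tube t (k : int) : set int := [set i + k * n%:Z | i in t].

Definition proper_tubing T : Prop :=
  [/\ T `<=` proper_tube,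
      forall t, T t -> forall k : int, T (shift_tube t k),
      forall s t, T s -> T t -> nested s t \/ disjoint_tubes s t &
      forall (m : nat) (t : nat -> set int),
        (forall l, (l <= m)%N -> T (t l)) ->
        (forall l, (l < m)%N -> tube_lt (t l) (t l.+1)) ->
        ~ tube_lt (t m) (t 0)].

Definition maximal_tubing T : Prop :=
  proper_tubing T /\ forall T', proper_tubing T' -> T `<=` T' -> T' = T.

End Tubings.

(** * Bi-infinite sequences modulo constant sequences *)

Section SequencesModConstants.
Variable R : realType.

Definition const_seq : {pred (int -> R^o)} :=
  fun x => `[< exists a : R, x = (fun=> a) >].

Fact const_seq_submod_closed : submod_closed const_seq.
Proof.
split; first by apply/asboolP; exists 0.
move=> a x y /asboolP [b ->] /asboolP [d ->]; apply/asboolP.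
by exists (a * b + d); apply/funext.
Qed.

HB.instance Definition _ :=
  GRing.isSubmodClosed.Build R (int -> R^o) const_seq const_seq_submod_closed.

Definition seqmod : Type := Quotient.quot (const_seq : zmodClosed (int -> R^o)).
HB.instance Definition _ := GRing.Zmodule.on seqmod.
HB.instance Definition _ := ZmodQuotient.on seqmod.

Definition seqmod_scale (a : R) (p : seqmod) : seqmod :=
  \pi_seqmod (a *: repr p).

Fact seqmod_eqP (x y : int -> R^o) :
  \pi_seqmod x = \pi_seqmod y <-> exists a : R, forall i, x i = y i + a.
Proof.
split.
  move/eqP; rewrite -Quotient.idealrBE => /asboolP [a xy].
  by exists a => i; rewrite -[a]/((fun=> a) i) -xy addrC subrK.
move=> [a xy]; apply/eqP; rewrite -Quotient.idealrBE; apply/asboolP; exists a.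
apply/funext => i; transitivity (x i - y i) => //.
by rewrite xy addrAC subrr add0r.
Qed.

Fact seqmod_reprP (x : int -> R^o) :
  exists a : R, forall i, repr (\pi_seqmod x) i = x i + a.
Proof. by apply/seqmod_eqP; rewrite reprK. Qed.

Fact pi_seqmod_scale (a : R) (x : int -> R^o) :
  \pi_seqmod (a *: x) = seqmod_scale a (\pi_seqmod x).
Proof.
have [b xb] := seqmod_reprP x.
apply/seqmod_eqP; exists (- (a * b)) => i.
transitivity (a * (x i + b) - a * b); first by rewrite mulrDr addrK.
by rewrite -xb.
Qed.

Fact pi_seqmod_surj (p : seqmod) : exists x, p = \pi_seqmod x.
Proof. by exists (repr p); rewrite reprK. Qed.

Fact seqmod_scalerA a b p :
  seqmod_scale a (seqmod_scale b p) = seqmod_scale (a * b) p.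
Proof.
by have [x ->] := pi_seqmod_surj p; rewrite -!pi_seqmod_scale scalerA.
Qed.

Fact seqmod_scale1r : left_id 1 seqmod_scale.
Proof.
by move=> p; have [x ->] := pi_seqmod_surj p; rewrite -pi_seqmod_scale scale1r.
Qed.

Fact seqmod_scalerDr : right_distributive seqmod_scale +%R.
Proof.
move=> a p q; have [x ->] := pi_seqmod_surj p; have [y ->] := pi_seqmod_surj q.
by rewrite -raddfD -!pi_seqmod_scale scalerDr raddfD.
Qed.

Fact seqmod_scalerDl p : {morph seqmod_scale^~ p : a b / a + b}.
Proof.
move=> a b; have [x ->] := pi_seqmod_surj p.
by rewrite -!pi_seqmod_scale scalerDl raddfD.
Qed.

HB.instance Definition _ := GRing.Zmodule_isLmodule.Build R seqmod
  seqmod_scalerA seqmod_scale1r seqmod_scalerDr seqmod_scalerDl.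

Fact pi_seqmod_linear : linear (\pi_seqmod : (int -> R^o) -> seqmod).
Proof. by move=> a x y; rewrite raddfD; congr (_ + _); exact: pi_seqmod_scale. Qed.

End SequencesModConstants.

(** * The realization *)

Section Realization.
Variables (R : realType) (n : nat) (P : affinePoset n).
Implicit Types (t : set int) (x : int -> R^o) (p : seqmod R).

Definition period_seq : set (int -> R^o) :=
  [set x | forall i, x (i + n%:Z) = x i + (n ^ (2 * n.+1))%:R].

(* This is an affine, not a linear, subspace of [seqmod R]. *)
Definition period_seqmod : set (seqmod R) := \pi_(seqmod R) @` period_seq.

(* Meaningful for finite [t] only. *)
Definition alpha_seq t x : R :=
  \sum_(e \in [set e : int * int | [/\ t e.1, t e.2 & covered P e.1 e.2]])
    (x e.2 - x e.1).

Definition alpha t p : R := alpha_seq t (repr p).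

Fact alpha_pi t x : alpha t (\pi x) = alpha_seq t x.
Proof.
have [a xa] := seqmod_reprP x.
by apply: eq_fsbigr => e _; rewrite !xa opprD addrACA subrr addr0.
Qed.

Definition halfspace t : set (seqmod R) :=
  period_seqmod `&` [set p | (n ^ (2 * #|` fset_set t|))%:R <= alpha t p].

(* Intersecting with [period_seqmod] matters when there is no proper tube,
   i.e. when [n = 1]. *)
Definition cyclohedron_realization : set (seqmod R) :=
  period_seqmod `&` \bigcap_(t in proper_tube P) halfspace t.

End Realization.

Arguments cyclohedron_realization R {n} P.

(* Main.v *)
(* A point of the realization makes some of the inequalities tight.  All edges
   being increasing, the values on a tube spread over at most alpha, so the
   fast growth of the right-hand sides n^(2|t|) forbids two tight tubes to
   overlap, or several of them to form a cycle: their convex hull would be a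
   tube (or contain two congruent elements) and violate its own inequality.
   Hence the tight tubes form a tubing.  Conversely, each tubing is the set of
   tight tubes of a point obtained by laying out the tubes from the inside
   outwards, the maximal subtubes of a tube being moved rigidly along a linear
   preorder that exists by acyclicity.

   Since subsets of tubings are tubings, the rest is formal: independence of the
   tight functionals, dimensions of faces and simplicity all follow from the
   fact that every subset of a set of tight inequalities is the set of tight
   inequalities of some point. *)
From HB Require Import structures.
From Stdlib Require Import Relation_Operators.
Require Import Defs.
From mathcomp Require Import all_boot all_order all_algebra finmap.
From mathcomp Require Import all_classical all_reals interval_inference convex.
From mathcomp Require Import ring lra zify.

Set Implicit Arguments.
Unset Strict Implicit.
Unset Printing Implicit Defensive.

Import Order.TTheory GRing.Theory Num.Theory.

Local Open Scope classical_set_scope.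
Local Open Scope ring_scope.
Local Open Scope quotient_scope.

(** * Polyhedra whose sets of tight inequalities form a simplicial complex *)

Section AffineDimension.
Variables (R : realType) (V : lmodType R).
Implicit Types A : set V.

(** The comparison of growth runs in two directions. On a connected set alpha bounds the spread of
    the values, and on a set of m elements alpha is at most m(m-1)/2 times the spread. As m(m-1)/2 <
    n^2 for m <= n, the factor n^2 gained by one more element is more than the number of edges can
    absorb, so the inequality of a tube forces a spread beyond what its smaller tight subtubes
    allow. The period c is the bound that a tube of n + 1 elements would have; congruent elements
    are at least c apart, so a hull of spread below c is a proper tube.

    A cycle of tubes may be arbitrarily long, so adding up the spreads of its tubes gives nothing.
    Instead, a value straddled by no tube of the cycle has the whole cycle on one side, while tubes
    straddling well separated values are disjoint and therefore few.

    There are infinitely many tubes, but only finitely many up to translation, and translates give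
    the same inequality. The polyhedron is therefore indexed by one tube from each class. *)

Lemma affinely_independent_comp m m' (h : 'I_m' -> 'I_m) (p : 'I_m -> V) :
  injective h -> affinely_independent p -> affinely_independent (p \o h).
Proof.
move=> h_inj ind c c0 cp0 j.
pose c' i := \sum_(j | h j == i) c j.
have c'h i : c' (h i) = c i.
  rewrite /c' (big_pred1 i) // => l /=.
  by rewrite (inj_eq h_inj).
rewrite -c'h; apply: ind.
  by rewrite -[RHS]c0 [in RHS](partition_big h predT).
rewrite -[RHS]cp0 [in RHS](partition_big h predT) //=.
apply: eq_bigr => i _; rewrite scaler_suml; apply: eq_bigr => l /eqP <- //.
Qed.

Lemma aff_dim_uniq A d d' : aff_dim A d -> aff_dim A d' -> d = d'.
Proof.
wlog lt_dd' : d d' / (d < d')%N.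
  move=> wl Ad Ad'; case: (ltngtP d d') => // lt_dd'; first exact: wl.
  by apply/esym; exact: wl.
move=> [_ nd] [[p Ap ind] _].
have le_dd' : (d.+2 <= d'.+1)%N by [].
case: (nd (p \o widen_ord le_dd')) => [i|]; first exact: Ap.
apply: affinely_independent_comp ind => i j /(congr1 val) /= ij.
exact: val_inj.
Qed.

(** For the upper bound, prefixing the coordinates of N + 2 points with a 1 gives N + 2 rows of
    length N + 1; a linear relation between them is an affine dependence of the points. *)
Lemma aff_dim_param N (e : 'I_N -> V) (p0 q : V) (eps : R) A :
  (forall y : 'I_N -> R, \sum_i y i *: e i = 0 -> forall i, y i = 0) ->
  (forall a, A a -> exists y : 'I_N -> R, a = p0 + \sum_i y i *: e i) ->
  A q -> eps != 0 -> (forall i, A (q + eps *: e i)) -> aff_dim A N.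
Proof.
move=> e_free A_sub Aq eps0 Ae; split.
  exists (fun i => if unlift ord0 i is Some j then q + eps *: e j else q).
    by move=> i; case: unliftP.
  move=> c; rewrite !big_ord_recl /= unlift_none => c0.
  under eq_bigr => i _ do rewrite liftK scalerDr scalerA mulrC -scalerA.
  rewrite big_split /= -scaler_suml addrA -scalerDl c0 scale0r add0r -scaler_sumr.
  move=> /eqP; rewrite scaler_eq0 (negPf eps0) /= => /eqP /e_free ce.
  move=> i; case: (unliftP ord0 i) => [j ->|->]; first exact: ce.
  by move: c0; rewrite big1 ?addr0.
move=> p Ap ind.
have [Y Yp] : exists Y : 'I_N.+2 -> 'I_N -> R,
    forall i, p i = p0 + \sum_j Y i j *: e j.
  exists (fun i => sval (cid (A_sub _ (Ap i)))) => i.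
  by case: cid.
pose M : 'M[R]_(N.+2, 1 + N) := row_mx (const_mx 1) (\matrix_(i, j) Y i j).
have : kermx M != 0.
  rewrite -mxrank_eq0 mxrank_ker -lt0n subn_gt0.
  by rewrite (leq_ltn_trans (rank_leq_col _)).
move/rowV0Pn => [v /sub_kermxP]; rewrite mul_mx_row -(row_mx0 R 1 1 N).
move/eq_row_mx => [v1 vY] /negP; apply.
have cv : \sum_i v 0 i = 0.
  move/matrixP/(_ 0 0): v1; rewrite !mxE => v1; rewrite -[RHS]v1.
  by apply: eq_bigr => i _; rewrite !mxE mulr1.
apply/eqP/rowP => i; rewrite mxE; apply: (ind (v 0)) => //.
under eq_bigr => j _ do rewrite Yp scalerDr scaler_sumr.
rewrite big_split /= -scaler_suml cv scale0r add0r exchange_big /=.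
apply: big1 => j _.
under eq_bigr => l _ do rewrite scalerA.
rewrite -scaler_suml.
move/rowP/(_ j): vY; rewrite !mxE => vY.
rewrite -[RHS](scale0r (e j)); congr (_ *: _); rewrite -[RHS]vY.
by apply: eq_bigr => l _; rewrite mxE.
Qed.

End AffineDimension.

(** Asking for the whole interval [0, eps] makes the condition stable under shrinking eps, so a
    finite minimum works. *)
Lemma common_eps (R : realType) (J : finType) (P : J -> R -> Prop) :
  (forall j, exists2 eps, 0 < eps & forall t, 0 <= t <= eps -> P j t) ->
  exists2 eps, 0 < eps & forall t, 0 <= t <= eps -> forall j, P j t.
Proof.
move=> epsP.
suff [eps eps0 epsQ] : exists2 eps : R, 0 < eps &
    forall t, 0 <= t <= eps -> forall j, j \in enum J -> P j t.
  by exists eps => // t /epsQ tP j; apply: tP; rewrite mem_enum.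
elim: (enum J) => [|j s [eps eps0 IH]]; first by exists 1.
have [eps' eps'0 jP] := epsP j.
exists (Num.min eps eps') => [|t]; first by rewrite lt_min eps0.
rewrite le_min => /and3P[t0 t1 t2] l; rewrite inE => /predU1P[->|].
  by apply: jP; rewrite t0.
by apply: IH; rewrite t0.
Qed.

Section Polyhedron.
Variables (R : realType) (V : lmodType R) (N : nat) (p0 : V) (e : 'I_N -> V).
Variables (I : finType) (f : I -> {scalar V}) (b : I -> R).
Implicit Types (p q d : V) (S : {set I}).

Definition comb (y : 'rV[R]_N) : V := \sum_i y 0 i *: e i.

(** The ambient space may be infinite-dimensional, hence the explicit parametrization of the affine
    subspace carrying the polyhedron. *)
Definition polyhedron : set V :=
  [set p | (exists y, p = p0 + comb y) /\ forall k, b k <= f k p].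

Definition act p : {set I} := [set k | f k p == b k]%SET.

Definition flat S : set V := [set p | polyhedron p /\ S \subset act p].

Hypothesis comb_inj : forall y, comb y = 0 -> y = 0.
Hypothesis poly_bounded : forall p y, polyhedron p -> comb y != 0 ->
  exists2 t : R, 0 <= t & ~ polyhedron (p + t *: comb y).
Hypothesis poly_neq0 : exists p, polyhedron p.
Hypothesis act_down : forall p S, polyhedron p -> S \subset act p ->
  exists2 q, polyhedron q & act q = S.

Let Q := polyhedron.

Lemma combD y z : comb (y + z) = comb y + comb z.
Proof.
rewrite -big_split; apply: eq_bigr => i _ /=; by rewrite mxE scalerDl.
Qed.

Lemma combZ a y : comb (a *: y) = a *: comb y.
Proof.
rewrite scaler_sumr; apply: eq_bigr => i _ /=; by rewrite mxE scalerA.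
Qed.

Lemma combN y : comb (- y) = - comb y.
Proof. by rewrite -[- y]scaleN1r combZ scaleN1r. Qed.

Lemma comb_mul m (z : 'rV[R]_m) (B : 'M_(m, N)) :
  comb (z *m B) = \sum_j z 0 j *: comb (row j B).
Proof.
transitivity (\sum_j \sum_i (z 0 j * B j i) *: e i).
  rewrite exchange_big; apply: eq_bigr => i _ /=; rewrite mxE scaler_suml //.
apply: eq_bigr => j _; rewrite scaler_sumr; apply: eq_bigr => i _.
by rewrite scalerA mxE.
Qed.

Lemma f_line k p t d : f k (p + t *: d) = f k p + t * f k d.
Proof. by rewrite linearD linearZ. Qed.

Lemma poly_sub p q : Q p -> Q q -> exists y, q = p + comb y.
Proof.
move=> [[y ->] _] [[z ->] _]; exists (z - y).
by rewrite combD combN -addrA; congr (_ + _); rewrite addrC subrK.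
Qed.

Lemma poly_line p t y : Q p -> (forall k, b k <= f k p + t * f k (comb y)) ->
  Q (p + t *: comb y).
Proof.
move=> [[z ->] _] bf; split; last by move=> k; rewrite f_line.
by exists (z + t *: y); rewrite combD combZ addrA.
Qed.

Lemma small_step p y : Q p -> (forall k, k \in act p -> 0 <= f k (comb y)) ->
  exists2 eps, 0 < eps & forall t, 0 <= t <= eps -> Q (p + t *: comb y).
Proof.
move=> Qp fy.
have [|eps eps0 H] := @common_eps R I
    (fun k t => b k <= f k p + t * f k (comb y)); last first.
  by exists eps => // t /H; exact: poly_line.
move=> k; have [kp|kp] := boolP (k \in act p).
  exists 1 => // t /andP[t0 _]; have [_ bk] := Qp.
  by rewrite ler_wpDr // mulr_ge0 // fy.
have bk : 0 < f k p - b k.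
  by rewrite subr_gt0 lt_neqAle; move: kp; rewrite inE eq_sym => -> /=; case: Qp.
have a0 : 0 < 1 + `|f k (comb y)| by rewrite ltr_pwDl.
(* The slack divided by the rate of change; the added 1 keeps the denominator positive when the
   functional vanishes on the direction. *)
exists ((f k p - b k) / (1 + `|f k (comb y)|)); first exact: divr_gt0.
move=> t /andP[t0]; rewrite ler_pdivlMr // => tb.
rewrite -lerBlDl -lerN2 opprB (le_trans _ tb) // mulrDr mulr1 -mulrN.
rewrite (le_trans _ (_ : t * `|f k (comb y)| <= _)) ?lerDr //.
by rewrite ler_wpM2l // -normrN ler_norm.
Qed.

(** Boundedness makes some functional decrease along the direction. The smallest ratio of slack to
    rate of decrease is the first time at which a new inequality becomes tight. *)
Lemma hit_boundary p y : Q p -> comb y != 0 ->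
  (forall k, k \in act p -> f k (comb y) = 0) ->
  exists t, [/\ 0 < t, Q (p + t *: comb y) & act p \proper act (p + t *: comb y)].
Proof.
move=> Qp y0 fy; have [_ bp] := Qp.
have [k0 fk0] : exists k, f k (comb y) < 0.
  apply: contrapT => nk; have [t t0] := poly_bounded Qp y0; apply.
  apply: poly_line => // k; rewrite ler_wpDr ?bp // mulr_ge0 //.
  by rewrite leNgt; apply/negP => fk; apply: nk; exists k.
pose tau k := (f k p - b k) / - f k (comb y).
case: (@arg_minP _ _ _ k0 [pred k | f k (comb y) < 0] tau fk0) => k /= fk tau_min.
have tau0 : 0 < tau k.
  rewrite divr_gt0 ?oppr_gt0 // subr_gt0 lt_neqAle bp andbT eq_sym.
  apply/negP => kp; move: fk; rewrite fy ?ltxx //.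
  by rewrite inE.
have Qt : Q (p + tau k *: comb y).
  apply: poly_line => // l; have [fl|fl] := ltP (f l (comb y)) 0; last first.
    by rewrite ler_wpDr ?bp // mulr_ge0 // ltW.
  have := tau_min _ fl; rewrite [X in _ <= X]/tau ler_pdivlMr ?oppr_gt0 // mulrN.
  by rewrite lerNl opprB lerBlDl.
exists (tau k); split => //; apply/properP; split.
  by apply/fintype.subsetP => l lp; move: (fy _ lp); move: lp;
    rewrite !inE f_line => /eqP-> ->; rewrite mulr0 addr0.
exists k; last first.
  by apply/negP => kp; move: fk; rewrite fy ?ltxx.
by rewrite inE f_line /tau invrN mulrN mulNr divfK ?subKr // lt_eqF.
Qed.

(** The slack at an interior point of a segment is a positive combination of the two nonnegative
    slacks at the ends, so it vanishes only if both do. *)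
Lemma act_conv p q (a : R) : Q p -> Q q -> 0 < a < 1 ->
  Q (p + a *: (q - p)) /\ act (p + a *: (q - p)) = act p :&: act q.
Proof.
move=> Qp Qq /andP[a0 a1]; have [y qp] := poly_sub Qp Qq.
have [_ bp] := Qp; have [_ bq] := Qq.
have fE k : f k (p + a *: (q - p)) = (1 - a) * f k p + a * f k q.
  by rewrite linearD linearZ /= linearB /=; lra.
split.
  rewrite qp addrAC subrr add0r; apply: poly_line => // k.
  have := bq k; rewrite qp linearD /= => ?; have := bp k; nra.
apply/setP => k; rewrite !inE fE; have := bp k; have := bq k.
move: (f k p) (f k q) (b k) => u v w vw uw.
apply/eqP/andP => [H|[/eqP-> /eqP->]]; last by ring.
have a1' : 0 < 1 - a by lra.
have H1 : 0 <= (1 - a) * (u - w) by apply: mulr_ge0; lra.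
have H2 : 0 <= a * (v - w) by apply: mulr_ge0; lra.
have : (1 - a) * (u - w) = 0 by lra.
have : a * (v - w) = 0 by lra.
by move=> /eqP; rewrite mulf_eq0 gt_eqF //= subr_eq0 => -> /eqP;
  rewrite mulf_eq0 gt_eqF //= subr_eq0.
Qed.

(* Dropping one element of [act p] at a time yields points separating the
   functionals tight at [p], so these are linearly independent. *)
Lemma flat_dim p : Q p -> aff_dim (flat (act p)) (N - #|act p|) /\ (#|act p| <= N)%N.
Proof.
move=> Qp; set S := act p.
pose G : 'M[R]_(N, #|S|) := \matrix_(i, k) f (enum_val k) (e i).
have fG y k : (y *m G) 0 k = f (enum_val k) (comb y).
  by rewrite mxE linear_sum; apply: eq_bigr => i _; rewrite mxE linearZ.
have rG : \rank G = #|S|.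
  rewrite -mxrank_tr; apply/eqP; rewrite -/(row_free G^T) -kermx_eq0.
  apply/rowV0P => w /sub_kermxP wG; apply/rowP => k; rewrite mxE.
  have wf y : \sum_l w 0 l * f (enum_val l) (comb y) = 0.
    have : y *m (w *m G^T)^T = 0 by rewrite wG trmx0 mulmx0.
    rewrite trmx_mul trmxK mulmxA => /matrixP /(_ 0 0); rewrite [RHS]mxE => yw.
    by rewrite -[RHS]yw mxE; apply: eq_bigr => l _; rewrite fG mxE mulrC.
  have kS : enum_val k \in S by exact: enum_valP.
  have [q Qq qS] := act_down Qp (subsetDl S [set enum_val k]).
  have [y qy] := poly_sub Qp Qq.
  have := wf y; rewrite (bigD1 k) //= big1 ?addr0 => [/eqP|l lk].
    rewrite mulf_eq0 => /orP[/eqP//|/eqP fk].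
    have : enum_val k \in act q.
      by rewrite inE qy linearD /= fk addr0; move: kS; rewrite inE.
    by rewrite qS !inE eqxx.
  have : enum_val l \in act q.
    by rewrite qS in_setD1 (inj_eq enum_val_inj) lk enum_valP.
  have := enum_valP l; rewrite !inE qy linearD /= => /eqP ->.
  by rewrite addrC -subr_eq0 addrK => /eqP ->; rewrite mulr0.
split; last by rewrite -rG rank_leq_row.
have rK : (N - #|S|)%N = \rank (kermx G) by rewrite mxrank_ker rG.
(* The rows of [B] span the directions on which every functional tight at p vanishes; small steps
   along them stay in the flat. *)
rewrite rK; pose B := row_base (kermx G).
pose e' j := comb (row j B).
have fe' k j : k \in S -> f k (e' j) = 0.
  move=> kS; rewrite -(enum_rankK_in kS kS) -fG.
  have /sub_kermxP -> : (row j B <= kermx G)%MS.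
    by rewrite -(eq_row_base (kermx G)) row_sub.
  by rewrite mxE.
have [|eps eps0 step] := @common_eps R _ (fun j t => Q (p + t *: e' j)).
  move=> j; apply: small_step => // k kS.
  by rewrite fe'.
apply: (@aff_dim_param _ _ _ e' p p eps).
- move=> y ye i; have : comb ((\row_i y i) *m B) = 0.
    by rewrite comb_mul -[RHS]ye; apply: eq_bigr => j _; rewrite mxE.
  move/comb_inj; rewrite -(mul0mx _ B) => /(row_free_inj (row_base_free _)).
  by move=> /rowP/(_ i); rewrite !mxE.
- move=> q [Qq /fintype.subsetP Sq]; have [y qy] := poly_sub Qp Qq.
  have /submxP[z zy] : (y <= B)%MS.
    rewrite eq_row_base; apply/sub_kermxP/rowP => k; rewrite fG mxE.
    have := Sq _ (enum_valP k); have := enum_valP k.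
    rewrite !inE qy linearD /= => /eqP -> /eqP.
    by move/(canRL (addKr _)) => ->; rewrite addNr.
  by exists (z 0); rewrite qy zy comb_mul.
- by split.
- by rewrite gt_eqF.
move=> j; split; first by apply: step; rewrite ltW //=.
apply/fintype.subsetP => k kS; rewrite inE f_line fe' // mulr0 addr0.
by move: kS; rewrite inE.
Qed.

Lemma flat_mono p q : Q p -> Q q ->
  flat (act p) `<=` flat (act q) <-> act q \subset act p.
Proof.
move=> Qp Qq; split => [|qp r [Qr pr]].
  by move=> /(_ p) []; [split|].
by split => //; apply: fintype.subset_trans pr.
Qed.

(** If the flat of p contains another point, the line through both can be followed inside the flat
    until a further inequality becomes tight. *)
Lemma flat_set1 p : Q p ->
  (exists v, flat (act p) = [set v]) <->
  (forall q, Q q -> act p \subset act q -> act q = act p).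
Proof.
move=> Qp; have pp : flat (act p) p by split.
split => [[v Fv] q Qq pq|pmax].
  have : flat (act p) q by split.
  by move: pp; rewrite Fv /= => -> ->.
exists p; apply/seteqP; split => [q [Qq pq]|_ -> //].
apply: contrapT => /= qp; have [y qy] := poly_sub Qp Qq.
have [||t [_ Qt /properP[sub [k kt kp]]]] := @hit_boundary p y Qp.
- by apply: contra_notN qp => /eqP y0; rewrite qy y0 addr0.
- move=> k kp; move/fintype.subsetP: pq => /(_ _ kp); move: kp.
  rewrite !inE qy linearD /= => /eqP-> /eqP.
  by move/(canRL (addKr _)) => ->; rewrite addNr.
by move: kp; rewrite -(pmax _ Qt sub) kt.
Qed.

(** The functional exposing the flat of [S] as a face: a sum of nonnegative slacks vanishes only if
    each does. The sign is there because [face] uses functionals bounded above. *)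
Definition neg_sum S (p : V) : R := - \sum_(k in S) f k p.

Lemma neg_sum_linear S : scalar (neg_sum S).
Proof.
move=> a x y; rewrite /neg_sum mulrN mulr_sumr -opprD -big_split /=.
by congr (- _); apply: eq_bigr => k _; rewrite linearP.
Qed.

HB.instance Definition _ S :=
  GRing.isLinear.Build R V R _ (neg_sum S) (neg_sum_linear S).

Lemma face_flat p : Q p -> face Q (flat (act p)).
Proof.
move=> Qp; split; first by exists p; split.
exists (neg_sum (act p) : {scalar V}), (- \sum_(k in act p) b k).
have bQ x : Q x -> \sum_(k in act p) b k <= \sum_(k in act p) f k x.
  by move=> [_ bx]; apply: ler_sum.
split=> [x Qx|]; first by rewrite lerN2 bQ.
apply/seteqP; split => x /= [Qx].
  move=> /fintype.subsetP px; split => //; congr (- _); apply: eq_bigr => k /px.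
  by rewrite inE => /eqP.
move/oppr_inj => bx; split => //; apply/fintype.subsetP => k kp; rewrite inE.
have : \sum_(k in act p) (f k x - b k) = 0.
  by rewrite sumrB bx subrr.
move=> /eqP; rewrite psumr_eq0.
  by move=> /allP /(_ k (mem_index_enum _)) /implyP /(_ kp); rewrite subr_eq0.
by case: Qx => _ bx' l _; rewrite subr_ge0.
Qed.

(* A point of [F] with the fewest tight inequalities can be pushed slightly
   away from any point of its flat, which forces the flat into [F]. *)
Lemma faceP F : face Q F -> exists2 p, F p & Q p /\ F = flat (act p).
Proof.
move=> [[x0 Fx0] [g [c [gc FE]]]].
have FQ x : F x -> Q x by rewrite FE => -[].
have [p Fp pmin] : exists2 p, F p & forall q, F q -> (#|act p| <= #|act q|)%N.
  have exn : exists n, `[< exists2 p, F p & #|act p| = n >].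
    by exists #|act x0|; apply/asboolP; exists x0.
  case: (ex_minnP exn) => m /asboolP [p Fp pm] mmin; exists p => // q Fq.
  by rewrite pm; apply: mmin; apply/asboolP; exists q.
have Qp := FQ _ Fp; exists p => //; split => //.
have gF x : F x -> g x = c by rewrite FE => -[].
apply/seteqP; split => q.
  move=> Fq; split; first exact: FQ.
  (* The midpoint lies in F and its tight set is the intersection of the two, so minimality puts
     [act p] inside [act q]. *)
  have h01 : 0 < (2^-1 : R) < 1 by lra.
  have [Qr Er] := act_conv Qp (FQ _ Fq) h01.
  have : F (p + 2^-1 *: (q - p)).
    rewrite FE; split => //=; rewrite linearD linearZ /= linearB /= !gF //.
    by rewrite subrr mulr0 addr0.
  move=> /pmin; rewrite Er => cE.
  by apply/finset.setIidPl/eqP; rewrite eqEcard subsetIl.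
move=> [Qq pq]; rewrite FE; split => //=; apply/eqP.
rewrite eq_le gc //=.
have [y py] := poly_sub Qq Qp.
have [|eps eps0 st] := @small_step p y Qp.
  move=> k kp; move/fintype.subsetP: pq => /(_ _ kp); move: kp.
  by rewrite !inE py linearD /= => /eqP <-;
    rewrite -subr_eq0 opprD addrA subrr sub0r oppr_eq0 => /eqP ->.
have := gc _ (st eps _); rewrite lexx ltW // => /(_ isT).
rewrite linearD linearZ /= (gF _ Fp) gerDl pmulr_rle0 // => gy.
by rewrite -(gF _ Fp) py linearD /= gerDl.
Qed.

(** The generators are the points with maximal tight set; each is determined by that set, so they
    are finitely many. By induction on the number of slack inequalities, any other point lies on a
    segment of its flat whose two ends have strictly larger tight sets. *)
Lemma polyhedron_polytope : polytope Q.
Proof.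
pose A := [set p | Q p /\ forall q, Q q -> act p \subset act q -> act q = act p].
exists A; split.
  have A_inj : set_inj A act.
    move=> p q /set_mem [Qp pm] /set_mem [Qq qm] pq.
    have [v Fv] := (flat_set1 Qp).2 pm.
    have : flat (act p) p by split.
    have : flat (act p) q by split; rewrite ?pq.
    by rewrite Fv /= => -> ->.
  by rewrite -(eq_finite_set (inj_card_eq A_inj)); exact: finite_finset.
apply/seteqP; split; last first.
  apply: smallest_sub => [|p []//].
  apply/convex_setW => p q; rewrite !inE => Qp Qq a a0 a1; rewrite inE.
  have [|Qr _] := @act_conv p q (1 - a%:num) Qp Qq; first by lra.
  suff -> : conv a p q = p + (1 - a%:num) *: (q - p) by [].
  rewrite /conv /= /unstable.onem scalerBr addrCA -[X in _ + (X - _)]scale1r -scalerBl.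
  by rewrite addrC subKr.
move=> p Qp.
move: {2}#|~: act p| (leqnn #|~: act p|) => n.
elim: n p Qp => [|n IH] p Qp np.
  apply: sub_gen_smallest; split => // q Qq pq; apply/eqP.
  rewrite finset.eqEsubset pq andbT; apply/fintype.subsetP => k _.
  by move: np; rewrite leqn0 cards_eq0 => /eqP/setP/(_ k); rewrite !inE => /negbFE.
have [pA|] := pselect (A p); first exact: sub_gen_smallest.
move=> nA.
have [q Qq pq] : exists2 q, Q q & act p \proper act q.
  apply: contrapT => nq; apply: nA; split => // q Qq pq; apply/eqP;
    rewrite eq_sym eqEproper pq /=.
  by apply/negP => pq'; apply: nq; exists q.
have [y qy] := poly_sub Qp Qq.
have y0 : comb y != 0.
  by apply/eqP => y0; move: pq; rewrite qy y0 addr0 fintype.properxx.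
have fy k : k \in act p -> f k (comb y) = 0.
  move=> kp; move/proper_sub/fintype.subsetP: pq => /(_ _ kp); move: kp.
  rewrite !inE qy linearD /= => /eqP-> /eqP.
  by move/(canRL (addKr _)) => ->; rewrite addNr.
have [t [t0 Qt pt]] := hit_boundary Qp y0 fy.
have [||u [u0 Qu pu]] := @hit_boundary p (- y) Qp.
- by rewrite combN oppr_eq0.
- by move=> k /fy fk; rewrite combN linearN /= fk oppr0.
have card_lt (r : V) : act p \proper act r -> (#|~: act r| <= n)%N.
  move=> /proper_card pr; rewrite -ltnS (leq_trans _ np) //.
  by have := cardsC (act p); have := cardsC (act r); lia.
move=> B [/= Bc AB].
have Bt := IH _ Qt (card_lt _ pt) B (conj Bc AB).
have Bu := IH _ Qu (card_lt _ pu) B (conj Bc AB).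
have tu0 : 0 < t + u by rewrite addr_gt0.
have w0 : 0 <= u / (t + u) by rewrite divr_ge0 // ltW.
have w1 : u / (t + u) <= 1 by rewrite ler_pdivrMr // mul1r lerDr ltW.
have := Bc _ _ (Itv01 w0 w1) (mem_set Bt) (mem_set Bu); rewrite inE.
suff -> : conv (Itv01 w0 w1) (p + t *: comb y : convex_lmodType V) (p + u *: comb (- y)) =
  p by [].
rewrite /conv /= /unstable.onem combN scalerN !scalerDr addrACA -scalerDl [X in X *:
  p]addrC subrK scale1r.
rewrite scalerN !scalerA -scalerBl.
suff -> : u / (t + u) * t - (1 - u / (t + u)) * u = 0 by rewrite scale0r addr0.
by field; rewrite gt_eqF.
Qed.

Lemma flat_set1_card p : Q p -> (exists v, flat (act p) = [set v]) -> #|act p| = N.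
Proof.
move=> Qp [v Fv]; have [dimF leN] := flat_dim Qp.
have dim0 : aff_dim [set v] 0.
  apply: (@aff_dim_param _ _ 0 (fun=> 0) v v 1) => //; first last.
  - by case.
  - by move=> a ->; exists (fun=> 0); rewrite big_ord0 addr0.
  - by move=> y _ [].
by move: dimF; rewrite Fv => /(aff_dim_uniq dim0); lia.
Qed.

(** Codimension counts tight inequalities, so a vertex has N of them and a facet exactly one. The
    facets through v are thus the flats of the singletons in [act v], each realized by [act_down]
    and distinct from the others. *)
Lemma polyhedron_simple : simple_polytope Q N.
Proof.
have flat0 : flat finset.set0 = Q.
  by apply/seteqP; split => [p []//|p Qp]; split => //; apply: finset.sub0set.
have dimQ : aff_dim Q N.
  have [p Qp] := poly_neq0; have [q Qq q0] := act_down Qp (finset.sub0set _).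
  by have [] := flat_dim Qq; rewrite q0 cards0 subn0 flat0.
split; [exact: polyhedron_polytope|exact: dimQ|move=> v /faceP [_ -> [Qv Fv]]].
have cardv : #|act v| = N by apply: flat_set1_card => //; exists v.
have -> : [set F | facet Q F /\ F v] =
    (fun k => flat [set k]%SET) @` [set k | k \in act v].
  apply/seteqP; split => [F [[/faceP[p Fp [Qp FE]]] [d [dQ dF]] Fpv]|_ [k kv <-]].
    have dN := aff_dim_uniq dimQ dQ.
    have [dp le_pN] := flat_dim Qp.
    have := aff_dim_uniq dF; rewrite FE => /(_ _ dp) dE.
    have /eqP/cards1P[k pk] : #|act p| = 1%N by lia.
    exists k; last by rewrite pk.
    by move: Fpv; rewrite FE => -[_]; rewrite pk finset.sub1set.
  have [|q Qq qk] := @act_down v [set k]%SET Qv.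
    by rewrite finset.sub1set.
  split; last by split => //; rewrite finset.sub1set.
  rewrite -qk; split; first exact: face_flat.
  have [dq] := flat_dim Qq; rewrite qk cards1 => N0.
  exists N.-1; rewrite prednK //; split => //.
  by move: dq; rewrite qk cards1 subn1.
have inj : {in [set k | k \in act v] &, injective (fun k => flat [set k]%SET)}.
  move=> k l; rewrite !inE => kv lv kl.
  have [|q Qq qk] := @act_down v [set k]%SET Qv; first by rewrite finset.sub1set.
  have : flat [set k]%SET q by split; rewrite ?qk.
  by rewrite kl => -[_]; rewrite qk finset.sub1set inE => /eqP.
rewrite (card_eql (inj_card_eq inj)).
have -> : [set k | k \in act v] = [set` [fset k in act v]%fset].
  by apply/seteqP; split => k /=; rewrite in_fset.
by apply/card_eq_fsetP; rewrite card_imfset //= -cardE.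
Qed.

End Polyhedron.

(** * Affine posets and tubes *)

Section AffinePosets.
Variable n : nat.
Hypothesis n_gt0 : (0 < n)%N.
Local Notation N := (n%:Z).

Lemma int_max (P : int -> Prop) k0 B :
  P k0 -> (forall k, P k -> k <= B) -> exists2 m, P m & forall k, P k -> k <= m.
Proof.
move=> Pk0 PB.
have exq : exists q : nat, `[< P (B - q%:Z) >].
  exists `|B - k0|%N; apply/asboolP; have := PB _ Pk0 => ?.
  by rewrite gez0_abs ?subr_ge0 // subKr.
case: (ex_minnP exq) => q /asboolP Pq qmin; exists (B - q%:Z) => // k Pk.
rewrite leNgt; apply/negP => lt_k.
have kB := PB _ Pk.
have := qmin `|B - k|%N; rewrite (_ : B - _ = k); last by lia.
by move/(_ (asboolT Pk)); lia.
Qed.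

(* [h i] is the sum over the residues [r] of the largest [k] with
   [r + k * n] below [i]: a normalized count of the elements below [i]. *)
Lemma exists_height (le : int -> int -> Prop) :
  (forall i, le i i) ->
  (forall i j k, le i j -> le j k -> le i k) ->
  (forall i j k, le i j -> le (i + k * N) (j + k * N)) ->
  (forall i, le i (i + N)) ->
  (forall i j, exists k, le i (j + k * N)) ->
  (forall i k, le i (i + k * N) -> 0 <= k) ->
  exists h : int -> int,
    [/\ forall i, h (i + N) = h i + N,
        forall i j, le i j -> h i <= h j,
        forall i j, le i j -> ~ le j i -> h i + 1 <= h j &
        forall i j j', le i j -> ~ le j i -> le j j' -> le j' j ->
          (j %% N)%Z != (j' %% N)%Z -> h i + 2 <= h j].
Proof.
move=> le_refl le_trans le_shift le_up le_cof le_back.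
have gP i (r : 'I_n) : exists g : int, le (r%:Z + g * N) i /\
    forall k, le (r%:Z + k * N) i -> k <= g.
  have [k ik] := le_cof i r%:Z.
  have [l0 rl0] : exists l, le (r%:Z + l * N) i.
    have [l rl] := le_cof r%:Z i; exists (- l).
    by have := le_shift _ _ (- l) rl; rewrite -addrA -mulrDl subrr mul0r addr0.
  have [|m rm mmax] := @int_max (fun l => le (r%:Z + l * N) i) _ k rl0.
    move=> l rl; have := le_trans _ _ _ rl ik.
    move/(le_shift _ _ (- l)); rewrite -!addrA -!mulrDl subrr mul0r addr0.
    by move/le_back; lia.
  by exists m.
pose g i r := sval (cid (gP i r)).
have gle i (r : 'I_n) : le (r%:Z + g i r * N) i by rewrite /g; case: cid => ? [].
have gmax i (r : 'I_n) k : le (r%:Z + k * N) i -> k <= g i r.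
  by move=> rk; have [_ mm] := svalP (cid (gP i r)); exact: mm.
have gmono i j (r : 'I_n) : le i j -> g i r <= g j r.
  by move=> ij; apply: gmax; exact: le_trans (gle _ _) ij.
have res j : exists r : 'I_n, exists k, j = r%:Z + k * N /\ r%:Z = (j %% N)%Z.
  have rn : (`|(j %% N)%Z| < n)%N by lia.
  exists (Ordinal rn), (j %/ N)%Z => /=; split; last by lia.
  by rewrite gez0_abs; lia.
(* Since j' lies below j, its own index k is at most [g j r]; if a translate of j' with index at
   least k lay below i, then j would too. *)
have gstrict i j j' (r : 'I_n) : le i j -> ~ le j i -> le j j' -> le j' j ->
    r%:Z = (j' %% N)%Z -> g i r + 1 <= g j r.
  move=> ij nji jj' j'j rj'.
  have [r' [k [jE]]] := res j'; rewrite -rj' => -[/ord_inj rE].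
  rewrite {r'}rE in jE.
  have kg : k <= g j r by apply: gmax; rewrite -jE.
  suff : g i r < k by lia.
  rewrite ltNge; apply/negP => kgi; apply: nji; apply: (le_trans _ j') => //.
  apply: (le_trans _ _ _ _ (gle i r)); rewrite jE.
  have [d gE] : exists d : nat, g i r = k + d%:Z by exists `|(g i r - k)%R|%N; lia.
  rewrite gE; elim: d {gE} => [|d IH]; first by rewrite addr0.
  apply: (le_trans _ _ _ IH); have := le_up (r%:Z + (k + d%:Z) * N).
  have -> : r%:Z + (k + d%:Z) * N + N = r%:Z + (k + d.+1%:Z) * N by rewrite intS; ring.
  exact.
exists (fun i => \sum_r g i r); split.
- move=> i; transitivity (\sum_(r < n) (g i r + 1)); last first.
    by rewrite big_split /= sumr_const card_ord natz.
  apply: eq_bigr => r _; apply/eqP; rewrite eq_le; apply/andP; split.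
    rewrite -lerBlDr; apply: gmax; have := le_shift _ _ (-1) (gle (i + N) r).
    by rewrite -!addrA -mulrDl mulN1r subrr addr0.
  apply: gmax; have := le_shift _ _ 1 (gle i r).
  by rewrite -!addrA -mulrDl mul1r.
- by move=> i j ij; apply: ler_sum => r _; exact: gmono.
- move=> i j ij nji; have [r [k [_ rj]]] := res j.
  rewrite (bigD1 r) //= [X in _ <= X](bigD1 r) //=.
  have := gstrict i j j r ij nji (le_refl j) (le_refl j) rj.
  have : \sum_(s | s != r) g i s <= \sum_(s | s != r) g j s.
    by apply: ler_sum => s _; exact: gmono.
  lra.
(* The residues of j and j' are distinct and each contributes a strict increase, hence the 2. *)
move=> i j j' ij nji jj' j'j nres; have [r [k [_ rj]]] := res j.
have [r' [k' [_ rj']]] := res j'.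
have rr' : r' != r by apply: contra nres => /eqP rr'; rewrite -rj -rj' rr'.
rewrite (bigD1 r) //= [X in _ <= X](bigD1 r) //= (bigD1 r') //= [X in _ <= _ + X](bigD1 r') //=.
have := gstrict i j j r ij nji (le_refl j) (le_refl j) rj.
have := gstrict i j j' r' ij nji jj' j'j rj'.
have : \sum_(s | (s != r) && (s != r')) g i s <= \sum_(s | (s != r) && (s != r')) g j s.
  by apply: ler_sum => s _; exact: gmono.
lra.
Qed.

Variable P : affinePoset n.
Local Notation "i <=P j" := (ale P i j) (at level 70).
Local Notation "i <P j" := (alt P i j) (at level 70).

Lemma ale_shiftk k i j : (i + k * N <=P j + k * N) = (i <=P j).
Proof.
have shn (m : nat) a b : (a + m%:Z * N <=P b + m%:Z * N) = (a <=P b).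
  elim: m a b => [|m IH] a b; first by rewrite mul0r !addr0.
  by rewrite -(IH a b) [RHS]ale_shift intS mulrDl mul1r -!addrA [N + _]addrC.
case: k => m; first exact: shn.
rewrite -(shn m.+1 (i + _)) NegzE -!addrA -mulrDl addNr mul0r !addr0 //.
Qed.

Lemma ale_up i k : 0 <= k -> i <=P i + k * N.
Proof.
case: k => // m _; elim: m => [|m IH]; first by rewrite mul0r addr0 ale_refl.
apply: ale_trans IH _; have := ale_addn P (i + m%:Z * N).
by rewrite intS mulrDl mul1r -addrA [N + _]addrC.
Qed.

Lemma ale_back i k : i <=P i + k * N -> 0 <= k.
Proof.
move=> ik; rewrite leNgt; apply/negP => k0.
have : i + k * N <=P i by rewrite -(ale_shiftk (- k)) -addrA -mulrDl subrr mul0r addr0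
  ale_up; lia.
move=> ki; have : i = i + k * N by apply: (@ale_anti _ P); rewrite ik.
nia.
Qed.

Lemma alt_shiftk k i j : (i + k * N <P j + k * N) = (i <P j).
Proof. by rewrite /alt ale_shiftk (inj_eq (addIr _)). Qed.

Lemma alt_neq i j : i <P j -> i <> j. Proof. by move=> /andP[/eqP]. Qed.
Lemma altW i j : i <P j -> i <=P j. Proof. by case/andP. Qed.

Lemma alt_nge i j : i <P j -> ~~ (j <=P i).
Proof.
move=> /andP[/eqP ij le_ij]; apply/negP => ji; apply: ij.
by apply: (@ale_anti _ P); rewrite le_ij.
Qed.

Lemma alt_le_trans j i k : i <P j -> j <=P k -> i <P k.
Proof.
move=> ij jk; apply/andP; split; last exact: ale_trans (altW ij) jk.
by apply: contraTneq jk => <-; exact: alt_nge.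
Qed.

Lemma le_alt_trans j i k : i <=P j -> j <P k -> i <P k.
Proof.
move=> ij jk; apply/andP; split; last exact: ale_trans ij (altW jk).
by apply: contraTneq ij => ->; exact: alt_nge.
Qed.

Lemma covered_shiftk k i j : covered P (i + k * N) (j + k * N) <-> covered P i j.
Proof.
rewrite /covered alt_shiftk; split=> -[ij nk]; split=> // l [il lj].
  by apply: (nk (l + k * N)); rewrite !alt_shiftk.
by apply: (nk (l - k * N)); split; rewrite -(alt_shiftk k) subrK.
Qed.

Lemma exists_ale_height : exists h : int -> int,
  (forall i, h (i + N) = h i + N) /\ forall i j, i <P j -> h i < h j.
Proof.
have [||||||h [hN _ hs _]] := @exists_height (ale P).
- exact: ale_refl.
- by move=> i j k; exact: ale_trans.
- by move=> i j k; rewrite ale_shiftk.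
- exact: ale_addn.
- exact: ale_cofinal.
- exact: ale_back.
by exists h; split => // i j ij; have := hs _ _ (altW ij) (negP (alt_nge ij)); lia.
Qed.

(** The strictly increasing integer height bounds the length of chains from i to j, so inserting
    intermediate elements must end with covers. *)
Lemma cover_chain i j : i <=P j ->
  clos_refl_trans int (fun a b => [/\ covered P a b, i <=P a & b <=P j]) i j.
Proof.
have [h [_ hlt]] := exists_ale_height.
have [m] := ubnP `|h j - h i|; elim: m i j => // m IH i j hm ij.
have [<-|ij'] := eqVneq i j; first exact: rt_refl.
have lt_ij : i <P j by rewrite /alt ij' ij.
have [[k [ik kj]]|nk] := pselect (exists k, (i <P k) /\ (k <P j)); last first.
  apply: rt_step; split; rewrite ?ale_refl //; split => // k ikj.
  by apply: nk; exists k.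
have hik := hlt _ _ ik; have hkj := hlt _ _ kj.
have mono a b a' b' : a' <=P a -> b <=P b' -> forall x y,
  clos_refl_trans int (fun u v => [/\ covered P u v, a <=P u & v <=P b]) x y ->
  clos_refl_trans int (fun u v => [/\ covered P u v, a' <=P u & v <=P b']) x y.
  move=> aa' bb' x y; elim=> [u v [uv au vb]|u|u v w _ uv _ vw].
  - by apply: rt_step; split => //; [exact: ale_trans au|exact: ale_trans vb _].
  - exact: rt_refl.
  - exact: rt_trans uv vw.
apply: (rt_trans _ _ _ k).
  by apply: (mono i k) (ale_refl _ _) (altW kj) _ _ _; apply: IH (altW ik); lia.
by apply: (mono k j) (altW ik) (ale_refl _ _) _ _ _; apply: IH (altW kj); lia.
Qed.

Lemma cover_mono_lt (R : realType) (x : int -> R) :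
  (forall i j, covered P i j -> x i < x j) -> forall i j, i <P j -> x i < x j.
Proof.
move=> xc i j ij.
suff H a b : clos_refl_trans int (fun a b => [/\ covered P a b, i <=P a & b <=P j]) a b ->
    a = b \/ x a < x b.
  by have [ij'|//] := H _ _ (cover_chain (altW ij)); have := alt_neq ij.
elim=> [u v [uv _ _]|u|u v w _ uv _ vw]; first by right; apply: xc.
  by left.
case: uv vw => [-> //|uv] [<-|vw]; right => //; exact: lt_trans uv vw.
Qed.

End AffinePosets.

(** * The functionals alpha *)

Section Alpha.
Variables (R : realType) (n : nat) (P : affinePoset n).
Implicit Types (s t : set int) (x y : int -> R^o).

Lemma covered_irr a b : covered P a b -> a <> b.
Proof. by case=> /alt_neq. Qed.

Lemma covered_asym a b : covered P a b -> ~ covered P b a.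
Proof. by move=> [ab _] [ba _]; have /negP := alt_nge ab; apply; exact: altW. Qed.

Definition edge t (e : int * int) : bool :=
  `[< [/\ t e.1, t e.2 & covered P e.1 e.2] >].

(** Any duplicate-free list containing the edges computes alpha, so alphas of two sets can be
    compared term by term over a common list. *)
Lemma alpha_seq_pairs t x (r : seq (int * int)) :
  uniq r -> (forall e, edge t e -> e \in r) ->
  alpha_seq P t x = \sum_(e <- r) if edge t e then x e.2 - x e.1 else 0.
Proof.
move=> r_uniq rt; rewrite -big_mkcond /alpha_seq.
rewrite (@fsbigE _ _ _ _ _ [seq e <- r | edge t e]) ?filter_uniq //.
- rewrite big_filter_cond /=; apply: eq_bigl => e.
  by apply/andP/idP => [[]//|et]; split => //; apply/mem_set/asboolP.
- by move=> e /=; rewrite mem_filter => /andP[/asboolP].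
by move=> e et; rewrite mem_filter negb_and => /orP[/asboolP//|]; rewrite rt //; apply/asboolP.
Qed.

Definition pairs t : seq (int * int) :=
  [seq (a, b) | a <- fset_set t, b <- fset_set t].

Lemma pairs_uniq t : uniq (pairs t).
Proof. by apply: allpairs_uniq => // -[? ?] [? ?] _ _ [-> ->]. Qed.

Lemma mem_pairs t s : finite_set t -> s `<=` t -> forall e, edge s e -> e \in pairs t.
Proof.
move=> tf st [a b] /asboolP [/= /st ta /st tb _].
by apply/allpairsP; exists (a, b); split; rewrite ?in_fset_set ?inE.
Qed.

Lemma alpha_seqE t x : finite_set t ->
  alpha_seq P t x = \sum_(e <- pairs t) if edge t e then x e.2 - x e.1 else 0.
Proof. by move=> tf; apply: alpha_seq_pairs (pairs_uniq t) (mem_pairs tf _). Qed.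

Lemma alpha_seq_ext t x y : (forall a b, t a -> t b -> x b - x a = y b - y a) ->
  alpha_seq P t x = alpha_seq P t y.
Proof.
by move=> xy; apply: eq_fsbigr => -[a b] /set_mem /= [ta tb _]; exact: xy.
Qed.

Lemma alpha_seq_lin t x y (a : R) : finite_set t ->
  alpha_seq P t (fun i => a * x i + y i) = a * alpha_seq P t x + alpha_seq P t y.
Proof.
move=> tf; rewrite !alpha_seqE // mulr_sumr -big_split /=.
by apply: eq_bigr => e _; case: ifP => _; ring.
Qed.

Lemma alpha_seq_shift t x k :
  alpha_seq P (shift_tube n t k) x = alpha_seq P t (fun i => x (i + k * n%:Z)).
Proof.
pose h (e : int * int) := (e.1 + k * n%:Z, e.2 + k * n%:Z).
rewrite /alpha_seq.
have -> : [set e | [/\ shift_tube n t k e.1, shift_tube n t k e.2 & covered P e.1 e.2]] =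
    h @` [set e : int * int | [/\ t e.1, t e.2 & covered P e.1 e.2]].
  apply/seteqP; split.
    move=> [_ _] /= [[a ta <-] [b tb <-] /covered_shiftk ab].
    by exists (a, b).
  move=> _ [[a b] /= [ta tb ab] <-] /=; split; first by exists a.
    by exists b.
  exact/covered_shiftk.
by rewrite fsbig_image // => -[a b] [c d] _ _ [/addIr -> /addIr ->].
Qed.

Lemma alpha_seq_edge x i j : covered P i j -> alpha_seq P [set i; j] x = x j - x i.
Proof.
move=> ij; rewrite (@alpha_seq_pairs _ _ [:: (i, j)]) //.
  by rewrite big_seq1 ifT //; apply/asboolP; split; [left|right|].
move=> [a b] /asboolP [/= [->|->] [->|->]] ab; rewrite ?inE ?eqxx //.
- by have := covered_irr ab.
- by have := covered_asym ij ab.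
- by have := covered_irr ab.
Qed.

Definition nondec_on t x := forall a b, t a -> t b -> covered P a b -> x a <= x b.

Lemma alpha_seq_ge0 t x : finite_set t -> nondec_on t x -> 0 <= alpha_seq P t x.
Proof.
move=> tf xt; rewrite alpha_seqE //; apply: sumr_ge0 => e _.
by case: ifP => // /asboolP [? ? ?]; rewrite subr_ge0; apply: xt.
Qed.

(** The edge joining a and b contributes exactly the absolute difference; every other new edge
    contributes a nonnegative amount. *)
Lemma alpha_seq_add t x a b : finite_set t -> nondec_on (a |` t) x ->
  ~ t a -> t b -> hasse P a b ->
  alpha_seq P t x + `|x a - x b| <= alpha_seq P (a |` t) x.
Proof.
move=> tf xt nta tb ab.
have tf' : finite_set (a |` t) by rewrite finite_setU; split.
have [e [et et' ew]] : exists e, [/\ edge (a |` t) e, ~~ edge t e & `|x a - x b| = x e.2 -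
  x e.1].
  have ta' : (a |` t) a by left.
  have tb' : (a |` t) b by right.
  case: ab => ab; [exists (a, b)|exists (b, a)]; split; try exact/asboolP.
  - by apply/asboolP => -[].
  - by rewrite distrC ger0_norm // subr_ge0; apply: xt.
  - by apply/asboolP => -[].
  - by rewrite ger0_norm // subr_ge0; apply: xt.
rewrite ew; rewrite (alpha_seqE _ tf') (@alpha_seq_pairs t x (pairs (a |` t))) ?pairs_uniq
  //; last first.
  by apply: mem_pairs tf' _; right.
have er : e \in pairs (a |` t) by apply: mem_pairs tf' _ _ et.
rewrite (bigD1_seq e) ?pairs_uniq //= (negPf et') add0r.
rewrite [X in _ <= X](bigD1_seq e) ?pairs_uniq //= et /= [X in X <= _]addrC lerD2l.
apply: ler_sum => f _; case: ifP => [/asboolP [fa fb fab]|_].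
  by rewrite ifT //; apply/asboolP; split => //; right.
by case: ifP => // /asboolP [? ? ?]; rewrite subr_ge0; apply: xt.
Qed.

Lemma alpha_seq_mono t s x : finite_set s -> t `<=` s -> nondec_on s x ->
  alpha_seq P t x <= alpha_seq P s x.
Proof.
move=> sf ts xs; rewrite (alpha_seqE _ sf) (@alpha_seq_pairs t x (pairs s)) ?pairs_uniq //.
  apply: ler_sum => f _; case: ifP => [/asboolP [/ts fa /ts fb fab]|_].
    by rewrite ifT //; apply/asboolP.
  by case: ifP => // /asboolP [? ? ?]; rewrite subr_ge0; apply: xs.
exact: mem_pairs.
Qed.

Lemma crt_path (T : eqType) (r : T -> T -> Prop) i j : clos_refl_trans T r i j ->
  exists2 p, path (fun a b => `[< r a b >]) i p & last i p = j.
Proof.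
elim=> {i j} [i j ij|i|i j k _ [p ip pj] _ [q jq qk]].
- by exists [:: j] => //=; rewrite andbT; apply/asboolP.
- by exists [::].
by exists (p ++ q); rewrite ?last_cat ?cat_path pj ?ip.
Qed.

(** Take a path without repeated vertices in the Hasse diagram. Its edges are distinct edges of t,
    so adding its vertices one at a time accumulates at least the distance between its ends. *)
Lemma alpha_seq_diam t x : finite_set t -> hasse_connected P t -> nondec_on t x ->
  forall i j, t i -> t j -> `|x j - x i| <= alpha_seq P t x.
Proof.
move=> tf tc xt i j ti tj.
have [p0 ip0 pj0] := crt_path (tc _ _ ti tj).
case/shortenP: ip0 pj0 => p ip pu _ pj.
set e := (fun a b => _) in ip.
have {}pt : {subset i :: p <= [pred a | `[< t a >]]}.
  move=> a; rewrite inE => /predU1P[->|]; first exact/asboolP.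
  elim: p i ip {pu pj ti} => // b p IH i /= /andP[/asboolP [_ tb _] bp].
  by rewrite inE => /predU1P[->|/(IH _ bp)//]; exact/asboolP.
suff H : `|x j - x i| <= alpha_seq P [set` i :: p] x.
  apply: le_trans H _; apply: alpha_seq_mono => // a /= /pt /asboolP //.
rewrite -pj; elim: p i ip pu pt {ti pj} => [|b p IH] i /=.
  by move=> _ _ _; rewrite subrr normr0; apply: alpha_seq_ge0 => // a c /= ;
    rewrite !inE => /eqP-> /eqP-> /covered_irr.
move=> /andP[/asboolP [ti tb ab] bp] /andP[ip pu] pt.
have pt' : {subset b :: p <= [pred a | `[< t a >]]}.
  by move=> c cp; apply: pt; rewrite inE cp orbT.
have -> : [set` i :: b :: p] = i |` [set` b :: p].
  apply/seteqP; split=> c /=; rewrite inE.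
    by move=> /predU1P[]; [left|right].
  by case=> [->|cp]; rewrite in_cons ?eqxx // in_cons cp orbT.
apply: le_trans (@alpha_seq_add _ _ _ b _ _ _ _ _) => //.
- apply: le_trans (lerD (IH _ bp pu pt') (lexx _)).
  by rewrite [X in _ <= _ + X]distrC; exact: ler_distD.
- have sub c : (i |` [set` b :: p]) c -> t c.
    by move=> [->//|/= cp]; apply/asboolP/pt'.
  by move=> c d /sub tc' /sub td; apply: xt.
- by apply/negP.
- by rewrite /= inE eqxx.
Qed.

(** At most one of (a, b) and (b, a) is a cover, so there are at most m(m-1)/2 edges, each of length
    at most D. *)
Lemma alpha_seq_upper t x (D : R) : finite_set t -> 0 <= D ->
  (forall i j, t i -> t j -> x j - x i <= D) ->
  2 * alpha_seq P t x <= (#|` fset_set t|%:R * (#|` fset_set t|%:R - 1)) * D.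
Proof.
move=> tf D0 xD; set X := fset_set t; set m := #|` X|.
have XE a : (a \in X) = `[< t a >].
  by rewrite /X in_fset_set //; apply/idP/asboolP => [/set_mem|/mem_set].
pose c a b : R := (edge t (a, b))%:R.
have cc a b : c a b + c b a <= (a != b)%:R.
  rewrite /c; have [->|ab] := eqVneq a b.
    have -> : edge t (b, b) = false by apply/asboolP => -[_ _ /covered_irr].
    by rewrite addr0.
  case E1 : (edge t (a, b)); case E2 : (edge t (b, a)); rewrite ?addr0 ?add0r //.
  by move/asboolP: E1 => [_ _ /covered_asym]; move/asboolP: E2 => [].
have le1 : alpha_seq P t x <= (\sum_(a <- X) \sum_(b <- X) c a b) * D.
  rewrite alpha_seqE // big_allpairs mulr_suml big_seq_cond [X in _ <= X]big_seq_cond.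
  apply: ler_sum => a /andP[aX _]; rewrite mulr_suml big_seq_cond [X in _ <= X]big_seq_cond.
  apply: ler_sum => b /andP[bX _]; rewrite /c; case: ifP => _; rewrite ?mul1r ?mul0r //=.
  by apply: xD; apply/asboolP; rewrite -XE.
have le2 : (\sum_(a <- X) \sum_(b <- X) c a b) * 2 <= m%:R * (m%:R - 1).
  rewrite mulrDr mulr1 [X in _ + X]exchange_big -big_split /=.
  have -> : m%:R * (m%:R - 1) = \sum_(a <- X) (m%:R - 1) :> R.
    by rewrite big_const_seq count_predT iter_addr_0 mulr_natl.
  rewrite big_seq_cond [X in _ <= X]big_seq_cond; apply: ler_sum => a /andP[aX _].
  rewrite -big_split /=; apply: (@le_trans _ _ (\sum_(b <- X) (a != b)%:R)).
    by apply: ler_sum => b _; exact: cc.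
  rewrite (bigD1_seq a) ?fset_uniq // eqxx /= add0r.
  have : \sum_(b <- X) (1 : R) = m%:R by rewrite big_const_seq count_predT iter_addr_0.
  rewrite (bigD1_seq a) ?fset_uniq //= => <-; rewrite addrAC subrr add0r.
  by apply: ler_sum => b ab; rewrite eq_sym ab.
have := ler_wpM2r D0 le2; lra.
Qed.

End Alpha.

(** * Convex hulls of unions of tubes *)

Section FiniteSets.
Implicit Types s t : set int.

Lemma card_fset_sub s t : finite_set t -> s `<=` t ->
  (#|` fset_set s| <= #|` fset_set t|)%N.
Proof.
move=> tf st; apply: fsubset_leq_card; apply/fsubsetP => i.
by rewrite !in_fset_set ?inE //; [exact: st|exact: sub_finite_set tf].
Qed.

Lemma card_fset_disjoint s t u : finite_set u -> s `<=` u -> t `<=` u -> s `&` t = set0 ->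
  (#|` fset_set s| + #|` fset_set t| <= #|` fset_set u|)%N.
Proof.
move=> uf su tu st0; have sf := sub_finite_set su uf; have tf := sub_finite_set tu uf.
have -> : (#|` fset_set s| + #|` fset_set t| = #|` fset_set (s `|` t)|)%N.
  rewrite fset_setU // cardfsU -fset_setI // st0 fset_set0 cardfs0 subn0 //.
by apply: card_fset_sub => // i [/su|/tu].
Qed.

Lemma card_fset_set1 (i : int) : #|` fset_set [set i]| = 1%N.
Proof. by rewrite fset_set1 cardfs1. Qed.

Lemma card_fset_proper s t i : finite_set t -> s `<=` t -> t i -> ~ s i ->
  (#|` fset_set s| < #|` fset_set t|)%N.
Proof.
move=> tf st ti nsi; rewrite -addn1 -(card_fset_set1 i).
apply: card_fset_disjoint => //; first by move=> _ ->.
by apply/seteqP; split => // j [sj ji]; apply: nsi; rewrite -ji.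
Qed.

Lemma card_ge2 t : finite_set t -> (`I_2 #<= t)%card = (2 <= #|` fset_set t|)%N.
Proof.
move=> tf; rewrite -card_le_II; apply: card_le_eqr.
by rewrite -[X in (X #= _)%card](fset_setK tf); apply/card_eq_fsetP.
Qed.

Lemma card_ge2P t : finite_set t -> (2 <= #|` fset_set t|)%N ->
  exists a b, [/\ t a, t b & a <> b].
Proof.
move=> tf; have [a|] := fset_0Vmem (fset_set t); first by rewrite a cardfs0.
move=> [a at_]; rewrite (cardfsD1 a) at_ add1n ltnS lt0n cardfs_eq0 => /fset0Pn[b].
rewrite in_fsetD1 => /andP[/eqP ba bt]; exists a, b; split => //; last by move/esym.
  by move: at_; rewrite in_fset_set ?inE.
by move: bt; rewrite in_fset_set ?inE.
Qed.

End FiniteSets.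

(** * Proper tubes, their translates and order-convex hulls *)

Section Tubes.
Variables (n : nat) (P : affinePoset n).
Hypothesis n_gt0 : (0 < n)%N.
Implicit Types (s t U : set int).
Local Notation N := (n%:Z).
Local Notation msize t := #|` fset_set t|.

Lemma proper_tube_inj t i j : proper_tube P t -> t i -> t j ->
  (i = j %[mod n])%Z -> i = j.
Proof. by move=> [[_ _ _ []] // + _]; apply. Qed.

Lemma proper_tube_injk t i k : proper_tube P t -> t i -> t (i + k * N) -> k = 0.
Proof.
move=> tp ti tk; have : i = i + k * N.
  by apply: (proper_tube_inj tp ti tk); rewrite addrC modzMDl.
move=> ik; have /eqP : k * N = 0 by lia.
by rewrite mulf_eq0 => /orP[/eqP//|]; lia.
Qed.

Lemma residue_inj_finite t :
  (forall i j, t i -> t j -> (i = j %[mod n])%Z -> i = j) ->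
  finite_set t /\ (msize t <= n)%N.
Proof.
move=> tinj; pose f (i : int) := `|(i %% N)%Z|%N.
have f_inj : {in t &, injective f}.
  move=> i j /set_mem ti /set_mem tj ij; apply: tinj => //.
  have : 0 <= (i %% N)%Z by apply: modz_ge0; lia.
  have : 0 <= (j %% N)%Z by apply: modz_ge0; lia.
  by move: ij; rewrite /f; lia.
have f_lt i : (f i < n)%N.
  have : 0 <= (i %% N)%Z by apply: modz_ge0; lia.
  have : (i %% N)%Z < N by apply: ltz_pmod; lia.
  by rewrite /f; lia.
have tf : finite_set t.
  rewrite -(eq_finite_set (inj_card_eq f_inj)).
  by apply: (@sub_finite_set _ _ `I_n) => // _ [i _ <-]; exact: f_lt.
split => //; rewrite -[n](size_iota 0) -(size_map f); apply: uniq_leq_size.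
  rewrite map_inj_in_uniq ?fset_uniq // => i j; rewrite !in_fset_set // => ti tj; exact: f_inj.
by move=> _ /mapP[i _ ->]; rewrite mem_iota add0n /=; exact: f_lt.
Qed.

Lemma proper_tube_finite t : proper_tube P t -> finite_set t.
Proof.
by move=> tp; have [] := residue_inj_finite (fun i j => @proper_tube_inj t i j tp).
Qed.

Lemma proper_tube_size t : proper_tube P t -> (2 <= msize t <= n)%N.
Proof.
move=> tp; have [tf ->] := residue_inj_finite (fun i j => @proper_tube_inj t i j tp).
by rewrite andbT -card_ge2 //; case: tp => -[].
Qed.

Lemma proper_tube_n2 t : proper_tube P t -> (2 <= n)%N.
Proof. by move=> /proper_tube_size; lia. Qed.

Lemma proper_tube_neq0 t : proper_tube P t -> exists i, t i.
Proof.
move=> tp; have /andP[t2 _] := proper_tube_size tp.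
by have [a [b []]] := card_ge2P (proper_tube_finite tp) t2; exists a.
Qed.

Lemma mk_proper_tube t a b : hasse_connected P t -> order_convex P t ->
  t a -> t b -> a <> b ->
  (forall i j, t i -> t j -> (i = j %[mod n])%Z -> i = j) -> proper_tube P t.
Proof.
move=> tc tv ta tb ab tinj; have [tf _] := residue_inj_finite tinj.
split; first (split=> //; last by right).
  rewrite card_ge2 //; have := @card_fset_proper [set a] t b tf; rewrite card_fset_set1.
  by apply => // [_ -> //|/esym].
move=> tT; have := tinj 0 N; rewrite tT modzz mod0z => /(_ I I erefl); lia.
Qed.

Lemma shift_tubeP t k i : shift_tube n t k i <-> t (i - k * N).
Proof.
split=> [[j tj <-]|ti]; first by rewrite addrK.
by exists (i - k * N); rewrite ?subrK.
Qed.

Lemma shift_tubeD t k l : shift_tube n (shift_tube n t k) l = shift_tube n t (k + l).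
Proof.
apply/seteqP; split=> i; rewrite !shift_tubeP;
by have -> : i - l * N - k * N = i - (k + l) * N by ring.
Qed.

Lemma shift_tube0 t : shift_tube n t 0 = t.
Proof. by apply/seteqP; split=> i; rewrite shift_tubeP mul0r subr0. Qed.

Lemma msize_shift t k : finite_set t -> msize (shift_tube n t k) = msize t.
Proof.
move=> tf; rewrite fset_set_image // card_imfset //; exact: addIr.
Qed.

Lemma proper_tube_shift t k : proper_tube P t -> proper_tube P (shift_tube n t k).
Proof.
move=> tp; have [a [b [ta tb ab]]] := card_ge2P (proper_tube_finite tp) (proj1 (andP
  (proper_tube_size tp))).
have [[tc tv _ _] _] := tp.
apply: (@mk_proper_tube _ (a + k * N) (b + k * N)).
- move=> i j /shift_tubeP ti /shift_tubeP tj.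
  rewrite -[i](subrK (k * N)) -[j](subrK (k * N)).
  elim: (tc _ _ ti tj) => [u v [tu tv' uv]|u|u v w _ uv _ vw].
  + apply: rt_step; split; [by exists u|by exists v|].
    by case: uv => uv; [left|right]; apply/covered_shiftk.
  + exact: rt_refl.
  + exact: rt_trans uv vw.
- move=> u v w /shift_tubeP tu /shift_tubeP tw uv vw; apply/shift_tubeP.
  by apply: (tv _ _ _ tu tw); rewrite -(ale_shiftk P k) !subrK.
- by exists a.
- by exists b.
- by move/addIr.
move=> i j /shift_tubeP ti /shift_tubeP tj ij.
have := proper_tube_inj tp ti tj; move=> H; apply: (addIr (- (k * N))); apply: H.
by rewrite -!mulNr -modzDml ij modzDml.
Qed.

Lemma cover_tube i j : covered P i j -> (i <> j %[mod n])%Z -> proper_tube P [set i; j].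
Proof.
move=> ij nij; apply: (@mk_proper_tube _ i j).
- have sij : [set i; j] i by left.
  have sj : [set i; j] j by right.
  move=> _ _ [->|->] [->|->]; try exact: rt_refl.
    by apply: rt_step; split=> //; left.
  by apply: rt_step; split=> //; right.
- move=> a b c sa sc ab bc; apply: contrapT => nb.
  have [ai bi] : b <> i /\ b <> j by split=> bb; apply: nb; [left|right].
  case: sa => /= aE; case: sc => /= cE; subst a c.
  - by apply: ai; apply: (@ale_anti _ P); rewrite ab bc.
  - case: ij => _ /(_ b); apply; split; rewrite /alt; first by rewrite ab andbT eq_sym;
    apply/eqP.
    by rewrite bc andbT; apply/eqP.
  - by case: ij => /alt_nge /negP + _; apply; exact: ale_trans bc.
  - by apply: bi; apply: (@ale_anti _ P); rewrite ab bc.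
- by left.
- by right.
- by move=> ij'; apply: nij; rewrite ij'.
- by move=> a b [->|->] [->|->] // ab; case: nij; rewrite ab.
Qed.

Definition hull U : set int :=
  [set b | exists a c, [/\ U a, U c, ale P a b & ale P b c]].

Lemma sub_hull U : U `<=` hull U.
Proof. by move=> i Ui; exists i, i; rewrite !ale_refl. Qed.

Lemma hull_convex U : order_convex P (hull U).
Proof.
move=> a b c [u [_ [Uu _ ua _]]] [_ [v [_ Uv _ cv]]] ab bc.
by exists u, v; split=> //; [exact: ale_trans ab|exact: ale_trans cv].
Qed.

(** Weaker than Hasse connectivity: in a union of tubes that is not convex, the covers between two
    comparable elements may leave the set. *)
Definition comparably_connected U := forall i j, U i -> U j ->
  clos_refl_trans int (fun a b => [/\ U a, U b & ale P a b || ale P b a]) i j.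

(** A comparability inside the hull refines to a chain of covers, and convexity keeps that chain in
    the hull. *)
Lemma hull_connected U : comparably_connected U -> hasse_connected P (hull U).
Proof.
move=> Uc; pose C := clos_refl_trans int (fun a b => [/\ hull U a, hull U b & hasse P a b]).
have Csym i j : C i j -> C j i.
  elim=> [u v [hu hv uv]|u|u v w _ uv _ vw].
  - by apply: rt_step; split => //; case: uv; [right|left].
  - exact: rt_refl.
  - exact: rt_trans vw uv.
have Cle i j : hull U i -> hull U j -> ale P i j -> C i j.
  move=> hi hj ij; elim: (cover_chain n_gt0 ij) => [u v [uv iu vj]|u|u v w _ uv _ vw].
  - apply: rt_step; split; last by left.
      by apply: (hull_convex hi hj) => //; apply: ale_trans vj; apply: altW; case: uv.
    by apply: (hull_convex hi hj) => //; apply: (ale_trans iu); apply: altW; case: uv.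
  - exact: rt_refl.
  - exact: rt_trans uv vw.
have CU i j : U i -> U j -> C i j.
  move=> Ui Uj; elim: (Uc _ _ Ui Uj) =>
    [u v [/sub_hull hu /sub_hull hv /orP[uv|vu]]|u|u v w _ uv _ vw].
  - exact: Cle.
  - exact/Csym/Cle.
  - exact: rt_refl.
  - exact: rt_trans uv vw.
move=> i j hi hj; have [a [_ [Ua _ ai _]]] := hi; have [b [_ [Ub _ bj _]]] := hj.
apply: (rt_trans _ _ _ a); first by apply/Csym/Cle => //; exact: sub_hull.
by apply: (rt_trans _ _ _ b); [exact: CU|apply: Cle => //; exact: sub_hull].
Qed.

Lemma connected_comparably t : hasse_connected P t -> comparably_connected t.
Proof.
move=> tc i j ti tj; elim: (tc _ _ ti tj) => [u v [tu tv uv]|u|u v w _ uv _ vw].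
- by apply: rt_step; split => //; case: uv => -[/altW ->]; rewrite ?orbT.
- exact: rt_refl.
- exact: rt_trans uv vw.
Qed.

Lemma crt_sub (r r' : int -> int -> Prop) i j : (forall a b, r a b -> r' a b) ->
  clos_refl_trans int r i j -> clos_refl_trans int r' i j.
Proof.
move=> rr'; elim=> [u v uv|u|u v w _ uv _ vw];
  [exact/rt_step/rr'|exact: rt_refl|exact: rt_trans uv vw].
Qed.

Lemma comparably_connectedU s t a b : comparably_connected s -> comparably_connected t ->
  s a -> t b -> ale P a b || ale P b a -> comparably_connected (s `|` t).
Proof.
move=> sc tc sa tb ab.
have scr i j : s i -> s j -> clos_refl_trans int (fun a b =>
  [/\ (s `|` t) a, (s `|` t) b & ale P a b || ale P b a]) i j.
  move=> si sj; apply: crt_sub (sc _ _ si sj) => u v [su sv uv].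
  by split => //; left.
have tcr i j : t i -> t j -> clos_refl_trans int (fun a b =>
  [/\ (s `|` t) a, (s `|` t) b & ale P a b || ale P b a]) i j.
  move=> ti tj; apply: crt_sub (tc _ _ ti tj) => u v [tu tv uv].
  by split => //; right.
move=> i j [si|ti] [sj|tj].
- exact: scr.
- apply: (rt_trans _ _ _ a); first exact: scr.
  apply: (rt_trans _ _ _ b); last exact: tcr.
  by apply: rt_step; split => //; [left|right].
- apply: (rt_trans _ _ _ b); first exact: tcr.
  apply: (rt_trans _ _ _ a); last exact: scr.
  by apply: rt_step; split => //; [right|left|rewrite orbC].
- exact: tcr.
Qed.

End Tubes.

(** * The tight tubes of a point form a tubing *)

Section ActiveTubes.
Variables (R : realType) (n : nat) (P : affinePoset n).
Hypothesis n_gt0 : (0 < n)%N.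
Local Notation N := (n%:Z).
Local Notation msize t := #|` fset_set t|.
Local Notation c := ((n ^ (2 * n.+1))%:R : R).
Implicit Types (s t U : set int).
Variable x : int -> R^o.
Hypothesis x_per : period_seq n x.
Hypothesis x_ge : forall t, proper_tube P t -> (n ^ (2 * msize t))%:R <= alpha_seq P t x.

Definition active : set (set int) :=
  [set t | proper_tube P t /\ alpha_seq P t x = (n ^ (2 * msize t))%:R].

Lemma period_shiftk k i : x (i + k * N) = x i + k%:~R * c.
Proof.
have H (m : nat) j : x (j + m%:Z * N) = x j + m%:R * c.
  elim: m j => [|m IH] j; first by rewrite !mul0r !addr0.
  rewrite intS mulrDl mul1r addrA IH x_per -natr1; ring.
case: k => m; first exact: H.
have E := H m.+1 (i + Negz m * N); rewrite NegzE -addrA -mulrDl addNr mul0r addr0 in E.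
have {}E : (x i : R) = (x (i + - m.+1%:Z * N) : R) + m.+1%:R * c := E.
have -> : (Negz m)%:~R = - m.+1%:R :> R by rewrite NegzE mulrNz -pmulrn.
by rewrite NegzE; apply/esym; rewrite mulNr; apply/eqP; rewrite subr_eq -E.
Qed.

Lemma c_gt0 : 0 < c. Proof. by rewrite ltr0n expn_gt0 n_gt0. Qed.

(** If the ends are congruent they differ by a positive multiple of c. Otherwise the two ends form a
    tube, whose inequality says that the edge has positive length. *)
Lemma cover_lt i j : covered P i j -> x i < x j.
Proof.
move=> ij; have [ijn|nij] := pselect (i = j %[mod n])%Z.
  have [k jE] : exists k, j = i + k * N.
    exists ((j %/ N)%Z - (i %/ N)%Z).
    by rewrite {1}(divz_eq j N) {1}(divz_eq i N) ijn; ring.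
  case: ij => /andP[ij leij] _; rewrite jE period_shiftk ltrDl mulr_gt0 ?c_gt0 // ltr0z.
  have k0 := ale_back n_gt0 (_ : ale P i (i + k * N)).
  rewrite lt_neqAle k0 -?jE // andbT eq_sym; apply: contra ij => /eqP k0'.
  by rewrite jE k0' mul0r addr0.
have tij := cover_tube n_gt0 ij nij.
rewrite -subr_gt0 -(alpha_seq_edge _ ij); apply: lt_le_trans (x_ge tij).
by rewrite ltr0n expn_gt0 n_gt0.
Qed.

Lemma ale_mono i j : ale P i j -> x i <= x j.
Proof.
have [->//|ij leij] := eqVneq i j; apply/ltW/(cover_mono_lt n_gt0 cover_lt).
by rewrite /alt ij.
Qed.

Lemma nondecr t : nondec_on P t x.
Proof. by move=> a b _ _ /cover_lt /ltW. Qed.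

Lemma tube_diam t i j : proper_tube P t -> t i -> t j -> x j - x i <= alpha_seq P t x.
Proof.
move=> tp ti tj; apply: le_trans (ler_norm _) _.
by apply: alpha_seq_diam ti tj;
  [exact: (proper_tube_finite n_gt0 tp)|case: tp => -[]|exact: nondecr].
Qed.

Lemma active_diam t i j : active t -> t i -> t j -> x j - x i <= (n ^ (2 * msize t))%:R.
Proof. by move=> [tp <-]; exact: tube_diam. Qed.

Lemma active_shift t k : active t -> active (shift_tube n t k).
Proof.
move=> [tp tE]; split; first exact: proper_tube_shift.
rewrite msize_shift; last exact: (proper_tube_finite n_gt0 tp).
rewrite alpha_seq_shift -tE; apply: alpha_seq_ext => a b _ _.
by rewrite !period_shiftk; ring.
Qed.

(** Values at congruent elements differ by a multiple of c, so a range below c leaves at most one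
    element in each residue class. *)
Lemma range_proper t a b : hasse_connected P t -> order_convex P t ->
  t a -> t b -> a <> b -> (forall i j, t i -> t j -> x j - x i < c) -> proper_tube P t.
Proof.
move=> tc tv ta tb ab tr; apply: (@mk_proper_tube _ _ n_gt0 _ a b) => //.
move=> i j ti tj ij; have [k jE] : exists k, j = i + k * N.
  exists ((j %/ N)%Z - (i %/ N)%Z).
  by rewrite {1}(divz_eq j N) {1}(divz_eq i N) ij; ring.
have := tr _ _ ti tj; have := tr _ _ tj ti.
rewrite jE period_shiftk opprD addrA subrr sub0r addrAC subrr add0r.
rewrite -mulNr -mulrNz -{2 4}[c]mul1r !ltr_pM2r ?c_gt0 // !ltrz1 => k1 k2.
have -> : k = 0 by lia.
by rewrite mul0r addr0.
Qed.

(** Turns the inequality of a tube into a lower bound on its spread; hulls of overlapping or cyclic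
    tight tubes are refuted by it. *)
Lemma range_size t (D : nat) : proper_tube P t ->
  (forall i j, t i -> t j -> x j - x i <= D%:R) ->
  (2 * n ^ (2 * msize t) <= msize t * (msize t - 1) * D)%N.
Proof.
move=> tp tD; have tf := proper_tube_finite n_gt0 tp.
have := @alpha_seq_upper R n P t x D%:R tf (ler0n _ _) tD.
have := x_ge tp; have /andP[m2 _] := proper_tube_size n_gt0 tp.
rewrite -(ler_nat R) !natrM natrB; last by lia.
move=> H1 H2; apply: le_trans H2; rewrite ler_pM2l //.
Qed.

Lemma hull_range U (D : R) : (forall i j, U i -> U j -> x j - x i <= D) ->
  forall i j, hull P U i -> hull P U j -> x j - x i <= D.
Proof.
move=> UD i j [a [_ [Ua _ ai _]]] [_ [b [_ Ub _ jb]]].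
by apply: le_trans (UD _ _ Ua Ub); apply: lerB; exact: ale_mono.
Qed.

Lemma hull_range_lt U (D : R) : (forall i j, U i -> U j -> x j - x i < D) ->
  forall i j, hull P U i -> hull P U j -> x j - x i < D.
Proof.
move=> UD i j [a [_ [Ua _ ai _]]] [_ [b [_ Ub _ jb]]].
by apply: le_lt_trans (UD _ _ Ua Ub); apply: lerB; exact: ale_mono.
Qed.

(** If s and t overlap without being nested, going through a common element bounds the spread on the
    hull of their union by n^(2|s|) + n^(2|t|) < c. The hull is then a tube of some size m > |s|,
    |t| and spread at most 2 n^(2(m-1)), so [range_size] would give n^2 <= m(m-1), contradicting m
    <= n. *)
Lemma active_nested s t : active s -> active t -> nested s t \/ disjoint_tubes s t.
Proof.
move=> sA tA; have [sp _] := sA; have [tp _] := tA.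
have [|/eqP/set0P [e [se te]]] := pselect (disjoint_tubes s t); first by right.
left; apply: contrapT => /not_orP [/existsNP [a /not_implyP [sa nta]] /existsNP [b
  /not_implyP [tb nsb]]].
have [sc _] : hasse_connected P s /\ True by case: sp => -[].
have [tc _] : hasse_connected P t /\ True by case: tp => -[].
pose U := s `|` t; pose D := (n ^ (2 * msize s) + n ^ (2 * msize t))%N.
have Uc : comparably_connected P U.
  by apply: (@comparably_connectedU _ _ _ _ e e); rewrite ?ale_refl //;
    exact: connected_comparably.
have UD i j : U i -> U j -> x j - x i <= D%:R.
  rewrite natrD => -[ui|ui] [uj|uj].
  - apply: le_trans (active_diam sA ui uj) _; by rewrite lerDl ler0n.
  - rewrite -(subrKA (x e)) addrC; apply: lerD; exact: active_diam.
  - rewrite -(subrKA (x e)); apply: lerD; exact: active_diam.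
  - apply: le_trans (active_diam tA ui uj) _; by rewrite lerDr ler0n.
have n2 := proper_tube_n2 n_gt0 sp.
have /andP[s2 sn] := proper_tube_size n_gt0 sp.
have /andP[t2 tn] := proper_tube_size n_gt0 tp.
have Dc : (D < n ^ (2 * n.+1))%N.
  have -> : (n ^ (2 * n.+1) = n * n * n ^ (2 * n))%N by rewrite mulnS expnD mulnn.
  have : (n ^ (2 * msize s) <= n ^ (2 * n))%N by rewrite leq_exp2l //; lia.
  have : (n ^ (2 * msize t) <= n ^ (2 * n))%N by rewrite leq_exp2l //; lia.
  have : (0 < n ^ (2 * n))%N by rewrite expn_gt0 n_gt0.
  rewrite /D; move: (n ^ (2 * n))%N (n ^ (2 * msize s))%N (n ^ (2 * msize t))%N.
  move=> w u v w0 vw uw; apply: (@leq_trans (4 * w)); first by lia.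
  by rewrite leq_mul2r; apply/orP; right; nia.
have hp : proper_tube P (hull P U).
  apply: (@range_proper _ e a) => //.
  - exact: hull_connected.
  - exact: hull_convex.
  - by apply: sub_hull; left.
  - by apply: sub_hull; left.
  - by move=> ea; apply: nta; rewrite -ea.
  - move=> i j hi hj; apply: le_lt_trans (hull_range UD hi hj) _.
    by rewrite ltr_nat.
have := range_size hp (hull_range UD).
have hf := proper_tube_finite n_gt0 hp.
have /andP[_ hn] := proper_tube_size n_gt0 hp.
have sh : (msize s < msize (hull P U))%N.
  apply: (@card_fset_proper _ _ b) => //; last by apply: sub_hull; right.
  by move=> i si; apply: sub_hull; left.
have th : (msize t < msize (hull P U))%N.
  apply: (@card_fset_proper _ _ a) => //; last by apply: sub_hull; left.
  by move=> i ti; apply: sub_hull; right.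
move: hn sh th; rewrite /D; set m := msize (hull P U) => hn sh th.
have -> : (n ^ (2 * m) = n * n * n ^ (2 * m.-1))%N.
  by rewrite mulnn -expnD; congr (_ ^ _)%N; lia.
have : (n ^ (2 * msize s) <= n ^ (2 * m.-1))%N by rewrite leq_exp2l //; lia.
have : (n ^ (2 * msize t) <= n ^ (2 * m.-1))%N by rewrite leq_exp2l //; lia.
have : (0 < n ^ (2 * m.-1))%N by rewrite expn_gt0 n_gt0.
move: (n ^ (2 * m.-1))%N (n ^ (2 * msize s))%N (n ^ (2 * msize t))%N => w u v w0 vw uw.
have mm : (m * (m - 1) < n * n)%N by nia.
nia.
Qed.

Definition hit (v : R) t := exists i j, [/\ t i, t j, x i <= v & v <= x j].

(* Tight tubes hitting two far apart values are disjoint, so by pigeonhole a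
   family of sufficiently many spaced values contains one that is not hit. *)
Lemma hit_close s t (B : nat) (v w : R) : active s -> active t -> (exists2 e, s e & t e) ->
  (msize s <= B)%N -> (msize t <= B)%N -> hit v s -> hit w t -> `|v - w| <= (n ^ (2 * B))%:R.
Proof.
move=> sA tA [e se te] sB tB [i [j [si sj iv vj]]] [i' [j' [ti' tj' iw wj]]].
have close u : active u -> (msize u <= B)%N -> s `<=` u -> t `<=` u ->
    `|v - w| <= (n ^ (2 * B))%:R.
  move=> uA uB su tu; apply: (@le_trans _ _ (n ^ (2 * msize u))%:R); last first.
    by rewrite ler_nat leq_pexp2l //; lia.
  have H1 := active_diam uA (su _ si) (tu _ tj').
  have H2 := active_diam uA (tu _ ti') (su _ sj).
  rewrite ler_norml; apply/andP; split; lra.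
have [[st|ts]|st0] := active_nested sA tA.
- by apply: (close t).
- by apply: (close s).
- by have : (s `&` t) e by []; rewrite st0.
Qed.

Lemma not_hit v t : active t -> ~ hit v t ->
  (forall i, t i -> v < x i) \/ (forall i, t i -> x i < v).
Proof.
move=> tA nh; have [e te] := proper_tube_neq0 n_gt0 (proj1 tA).
have [ve|ev] := ltP v (x e); [left|right] => i ti; rewrite ltNge; apply/negP => H; apply: nh.
  by exists i, e; split=> //; exact: ltW.
by exists e, i.
Qed.

(** * Excluding cycles of tight tubes *)

Section Cycle.
Variables (M : nat) (t : nat -> set int).
Hypothesis tA : forall l, (l <= M)%N -> active (t l).
Hypothesis t_lt : forall l, (l < M)%N -> tube_lt P (t l) (t l.+1).
Hypothesis t_cyc : tube_lt P (t M) (t 0).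

Lemma above_lt v s s' : tube_lt P s s' -> active s' -> ~ hit v s' ->
  (forall i, s i -> v < x i) -> (forall i, s' i -> v < x i).
Proof.
move=> [_ [a [b [sa s'b ab]]]] s'A nh vs; have [//|s'v] := not_hit s'A nh.
have := vs _ sa; have := s'v _ s'b; have := ale_mono (altW ab); lra.
Qed.

(** Lying above a value that is not hit passes from each tube to its successor, hence all the way
    around the cycle: it holds for all tubes or for none. *)
Lemma gap_cycle v : (forall l, (l <= M)%N -> ~ hit v (t l)) ->
  (forall l, (l <= M)%N -> forall i, t l i -> v < x i) \/
  (forall l, (l <= M)%N -> forall i, t l i -> x i < v).
Proof.
move=> nh.
have up l k : (l + k <= M)%N -> (forall i, t l i -> v < x i) ->
    forall i, t (l + k)%N i -> v < x i.
  elim: k => [|k IH] lk vl; first by rewrite addn0.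
  rewrite addnS; apply: (@above_lt v (t (l + k)%N)); first by apply: t_lt; lia.
  - by apply: tA; lia.
  - by apply: nh; lia.
  - by apply: IH => //; lia.
have wrap : (forall i, t M i -> v < x i) -> forall i, t 0 i -> v < x i.
  by move=> vM; apply: (above_lt t_cyc) => //; [exact: tA|exact: nh].
have [t0|t0] := not_hit (tA (leq0n M)) (nh _ (leq0n M)).
  by left=> l lM; rewrite -(add0n l); apply: up.
right=> l lM; have [tl|//] := not_hit (tA lM) (nh _ lM).
have [e te] := proper_tube_neq0 n_gt0 (proj1 (tA (leq0n M))).
have : v < x e.
  by apply: wrap te; rewrite -(subnKC lM); apply: up; rewrite // subnKC.
by have := t0 _ te; lra.
Qed.

Definition cycle_union : set int := [set i | exists2 l, (l <= M)%N & t l i].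

Lemma cycle_union_connected : comparably_connected P cycle_union.
Proof.
have H l : (l <= M)%N -> comparably_connected P [set i | exists2 k, (k <= l)%N & t k i].
  elim: l => [|l IH] lM.
    have -> : [set i | exists2 k, (k <= 0)%N & t k i] = t 0.
      by apply/seteqP; split=> i; [move=> [k]; rewrite leqn0 => /eqP ->|exists 0%N].
    by apply: connected_comparably; case: (tA (leq0n M)) => -[[]].
  have -> : [set i | exists2 k, (k <= l.+1)%N & t k i] =
      [set i | exists2 k, (k <= l)%N & t k i] `|` t l.+1.
    apply/seteqP; split=> i.
      move=> [k]; rewrite leq_eqVlt => /predU1P[->|kl ti]; first by right.
      by left; exists k.
    move=> [[k kl ti]|ti]; last by exists l.+1.
    by exists k => //; lia.
  have [_ [a [b [ta tb ab]]]] := t_lt lM.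
  apply: (@comparably_connectedU _ _ _ _ a b); rewrite ?(altW ab) //.
  - by apply: IH; lia.
  - by apply: connected_comparably; case: (tA lM) => -[[]].
  - by exists l.
exact: H.
Qed.

Lemma cycle_size l : (l <= M)%N -> finite_set (hull P cycle_union) ->
  (msize (t l) + 2 <= msize (hull P cycle_union))%N.
Proof.
move=> lM hf; have [l' l'M ll'] : exists2 l', (l' <= M)%N & t l `&` t l' = set0.
  have [lM'|] := ltnP l M; first by exists l.+1 => //; case: (t_lt lM').
  by exists 0%N => //; have -> : l = M by [lia|]; case: t_cyc.
have /andP[t2 _] := proper_tube_size n_gt0 (proj1 (tA l'M)).
apply: leq_trans (card_fset_disjoint hf _ _ ll'); first by rewrite leq_add2l.
  by move=> i ti; apply: sub_hull; exists l.
by move=> i ti; apply: sub_hull; exists l'.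
Qed.

(* Modulo [c], one of the [n + 1] multiples of [c / (n + 1)] is hit by no tight
   tube, and no cycle of tubes can pass such a value. *)
Lemma cycle_range : forall i j, cycle_union i -> cycle_union j -> x j - x i < c.
Proof.
have n2 := proper_tube_n2 n_gt0 (proj1 (tA (leq0n M))).
pose w : R := c / n.+1%:R.
have w0 : 0 < w by rewrite divr_gt0 ?c_gt0.
have wc : w * n.+1%:R = c by rewrite divfK // pnatr_eq0.
(* The spacing exceeds every bound of a tight tube, whose size is at most n, because n + 1 < n^2 for
   n >= 2. *)
have wn : (n ^ (2 * n))%:R < w.
  rewrite ltr_pdivlMr // -natrM ltr_nat [(2 * n.+1)%N]mulnS expnD mulnC ltn_pmul2r
    ?expn_gt0 ?n_gt0 //.
  by rewrite expnS expn1; nia.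
have [q nq] : exists q : nat, forall (k : int) s, active s -> ~ hit ((q%:Z + k *
  n.+1%:Z)%:~R * w) s.
  apply: contrapT => /forallNP nq.
  have ex (q : 'I_n.+1) : exists ks : int * set int, active ks.2 /\
      hit ((q%:Z + ks.1 * n.+1%:Z)%:~R * w) ks.2.
    have /existsNP[k /existsNP[s /not_implyP[sA /contrapT sh]]] := nq q.
    by exists (k, s).
  pose g q := sval (cid (ex q)).
  have gA q : active (g q).2 by case: (svalP (cid (ex q))).
  have gh (q : 'I_n.+1) : hit ((q%:Z + (g q).1 * n.+1%:Z)%:~R * w) (g q).2 by case: (svalP
    (cid (ex q))).
  pose e q := sval (cid (proper_tube_neq0 n_gt0 (proj1 (gA q)))).
  have eg q : (g q).2 (e q) by exact: (svalP (cid (proper_tube_neq0 n_gt0 (proj1 (gA q))))).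
  have e_lt q : (`|(e q %% N)%Z|%N < n)%N.
    have : 0 <= (e q %% N)%Z by apply: modz_ge0; lia.
    have : (e q %% N)%Z < N by apply: ltz_pmod; lia.
    lia.
  (* Each of the n + 1 values is assigned an element of a tube hitting it. Two of these elements are
     congruent, and a translation makes their tubes meet. *)
  have /injectivePn [q [q' qq' /(congr1 val) /= rq]] : ~~ injectiveb (fun q =>
    Ordinal (e_lt q)).
    apply/negP => /injectiveP inj; have := leq_card _ inj; rewrite !card_ord; lia.
  pose k := (e q' %/ N)%Z - (e q %/ N)%Z.
  have eE : e q' = e q + k * N.
    have : 0 <= (e q %% N)%Z by apply: modz_ge0; lia.
    have : 0 <= (e q' %% N)%Z by apply: modz_ge0; lia.
    have := divz_eq (e q) N; have := divz_eq (e q') N.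
    rewrite /k mulrBl; lia.
  have hq : hit ((q%:Z + ((g q).1 + k) * n.+1%:Z)%:~R * w) (shift_tube n (g q).2 k).
    have [i [j [gi gj xi xj]]] := gh q.
    have vE : (q%:Z + ((g q).1 + k) * n.+1%:Z)%:~R * w =
        (q%:Z + (g q).1 * n.+1%:Z)%:~R * w + k%:~R * c.
      by rewrite -wc !intrD !intrM !intrD; ring.
    exists (i + k * N), (j + k * N); rewrite !period_shiftk vE !lerD2r; split => //.
      by exists i.
    by exists j.
  have e_both : exists2 e0, shift_tube n (g q).2 k e0 & (g q').2 e0.
    by exists (e q') => //; rewrite eE; exists (e q).
  have sizeA s : active s -> (msize s <= n)%N.
    by move=> [/(proper_tube_size n_gt0) /andP[]].
  have := hit_close (active_shift k (gA q)) (gA q') e_both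
    (sizeA _ (active_shift k (gA q))) (sizeA _ (gA q')) hq (gh q').
  apply/negP; rewrite -ltNge -mulrBl normrM (gtr0_norm w0).
  apply: (lt_le_trans wn); rewrite -{1}[w]mul1r ler_pM2r // -intrB -intr_norm ler1z.
  rewrite -gtz0_ge1 normr_gt0 subr_eq0; apply: contra qq' => /eqP AB.
  apply/eqP/val_inj => /=.
  have qn := ltn_ord q; have qn' := ltn_ord q'.
  pose z := (g q').1 - (g q).1 - k.
  have zE : (q : nat)%:Z - (q' : nat)%:Z = z * n.+1%:Z by rewrite /z !mulrBl; lia.
  have [z0|[z1|z1]] : z = 0 \/ z >= 1 \/ z <= -1 by lia.
  - by move: zE; rewrite z0 mul0r; lia.
  - nia.
  - nia.
have [e te] := proper_tube_neq0 n_gt0 (proj1 (tA (leq0n M))).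
(* Chosen so that [x e] lies between two consecutive translates, c apart, of the value that is not
   hit; the whole cycle is then confined between them. *)
pose k := Num.floor ((x e / w - q%:R) / n.+1%:R).
have vk : (q%:Z + k * n.+1%:Z)%:~R * w <= x e.
  rewrite -ler_pdivlMr // intrD intrM -lerBrDl -ler_pdivlMr ?ltr0n //.
  exact: Num.Theory.floor_le.
have vk1 : x e < (q%:Z + (k + 1) * n.+1%:Z)%:~R * w.
  rewrite -ltr_pdivrMr // [X in _ < X]intrD intrM -ltrBlDl -ltr_pdivrMr ?ltr0n //.
  exact: Num.Theory.floorD1_gt.
have vE : (q%:Z + (k + 1) * n.+1%:Z)%:~R * w = (q%:Z + k * n.+1%:Z)%:~R * w + c.
  by rewrite -wc !intrD !intrM !intrD; ring.
have gap_k k' := gap_cycle (fun l lM => nq k' _ (tA lM)).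
move=> i j [l lM tli] [l' lM' tlj].
have [vi|vi] := gap_k k; last by have := vi _ (leq0n M) _ te; lra.
have [vj|vj] := gap_k (k + 1); first by have := vj _ (leq0n M) _ te; lra.
have := vi _ lM _ tli; have := vj _ lM' _ tlj; lra.
Qed.

(* Two tubes of the cycle are disjoint, so each of them has at most [m - 2]
   elements, where [m] is the size of the hull; this leaves room for a gap. *)
Lemma active_cycle_absurd : False.
Proof.
have n2 := proper_tube_n2 n_gt0 (proj1 (tA (leq0n M))).
pose rho := hull P cycle_union.
have [a [b [ta tb ab]]] := card_ge2P (proper_tube_finite n_gt0 (proj1 (tA (leq0n M))))
  (proj1 (andP (proper_tube_size n_gt0 (proj1 (tA (leq0n M)))))).
have sub l : (l <= M)%N -> t l `<=` rho by move=> lM i ti; apply: sub_hull; exists l.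
have rp : proper_tube P rho.
  apply: (@range_proper _ a b) => //.
  - by apply: hull_connected => //; exact: cycle_union_connected.
  - exact: hull_convex.
  - exact: (sub 0%N).
  - exact: (sub 0%N).
  - by apply: hull_range_lt; exact: cycle_range.
have rf := proper_tube_finite n_gt0 rp.
have /andP[_ rn] := proper_tube_size n_gt0 rp.
set m := msize rho in rn.
have tsize l : (l <= M)%N -> (msize (t l) <= m - 2)%N.
  by move=> lM; have := cycle_size lM rf; rewrite -/rho -/m; lia.
pose d := (n ^ (2 * (m - 2)))%N.
have d0 : (0 < d)%N by rewrite expn_gt0 n_gt0.
have UD : forall i j, cycle_union i -> cycle_union j -> x j - x i <= (2 * d * m.+1)%:R.
  (* Otherwise m + 1 values spaced by 2d lie between [x i] and [x j], each hit by a tube of the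
     cycle. The spacing exceeds d, which bounds the spread of each tube, so tubes hitting different
     values are disjoint and supply m + 1 distinct elements of a hull of size m. *)
  move=> i j [l lM tli] [l' lM' tlj]; rewrite leNgt; apply/negP => xij.
  pose v q : R := x i + (2 * d * q)%:R.
  have ex (q : 'I_m.+1) : exists k : nat, (k <= M)%N /\ hit (v q.+1) (t k).
    apply: contrapT => /forallNP nh.
    have vj : v q.+1 < x j.
      rewrite -ltrBrDl; apply: le_lt_trans xij.
      by rewrite ler_nat leq_mul2l ltn_ord orbT.
    have [H|H] := @gap_cycle (v q.+1) (fun k kM => fun h => nh k (conj kM h)).
      by have := H _ lM _ tli; rewrite /v ltNge lerDl ler0n.
    by have := H _ lM' _ tlj; lra.
  pose g q := sval (cid (ex q)).
  have gM q : (g q <= M)%N by case: (svalP (cid (ex q))).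
  have gh (q : 'I_m.+1) : hit (v q.+1) (t (g q)) by case: (svalP (cid (ex q))).
  have neq q := proper_tube_neq0 n_gt0 (proj1 (tA (gM q))).
  pose e q := sval (cid (neq q)).
  have eg q : t (g q) (e q) by exact: (svalP (cid (neq q))).
  have er q : e q \in fset_set rho by rewrite in_fset_set // inE; apply: (sub _ (gM q)).
  have /injectivePn [q [q' qq' /(congr1 val) /= eE]] :
      ~~ injectiveb (fun q => FSetSub (er q)).
    apply/negP => /injectiveP inj; have := leq_card _ inj.
    by rewrite card_ord -cardfE -/m ltnn.
  have e_both : exists2 e0, t (g q) e0 & t (g q') e0.
    by exists (e q) => //; rewrite eE.
  have := hit_close (tA (gM q)) (tA (gM q')) e_both (tsize _ (gM q)) (tsize _ (gM q')) (gh
    q) (gh q').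
  apply/negP; rewrite -ltNge /v -/d opprD addrACA subrr add0r.
  have [lt_q|lt_q|/val_inj qE] := ltngtP q q'; last by move: qq'; rewrite qE eqxx.
    rewrite distrC -natrB; last by rewrite leq_mul2l; apply/orP; right; lia.
    by rewrite -mulnBr normr_nat ltr_nat; nia.
  rewrite -natrB; last by rewrite leq_mul2l; apply/orP; right; lia.
  by rewrite -mulnBr normr_nat ltr_nat; nia.
(* After cancellation of 2d this says n^4 <= m(m-1)(m+1), whereas m^3 - m < n^3 < n^4. *)
have := range_size rp (hull_range UD); rewrite -/rho -/m.
have t2 := proj1 (andP (proper_tube_size n_gt0 (proj1 (tA (leq0n M))))).
have m4 := tsize _ (leq0n M).
have -> : (n ^ (2 * m) = n * n * (n * n) * d)%N.
  by rewrite /d -[(n * n)%N]/(n ^ 2)%N -!expnD; congr (_ ^ _)%N; lia.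
have mm : (m * (m - 1) * m.+1 < n * n * n)%N.
  apply: (@leq_trans (m * m * m)); last by rewrite !leq_mul.
  nia.
have nn : (n * n * n < n * n * (n * n))%N by nia.
move: d0 mm nn; move: (n * n * n)%N (n * n * (n * n))%N (m * (m - 1))%N.
move=> u v w d0 wu uv; nia.
Qed.

End Cycle.

Lemma active_proper_tubing : proper_tubing P active.
Proof.
split.
- by move=> t [].
- by move=> t tA k; exact: active_shift.
- exact: active_nested.
- move=> M t tA t_lt t_cyc; exact: (active_cycle_absurd tA t_lt t_cyc).
Qed.

End ActiveTubes.

(** * Every tubing is the set of tight tubes of some point *)

Lemma finite_argmax (R : realType) (A : set int) (f : int -> R) a :
  finite_set A -> A a -> exists2 m, A m & forall j, A j -> f j <= f m.
Proof.
move=> Af Aa; have [s As] := (finite_seqP A).1 Af; rewrite As in Aa *.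
elim: s a Aa {As} => // b s IH a _.
case: s IH => [|b' s] IH.
  by exists b; rewrite /= ?mem_head // => j; rewrite inE => /eqP ->.
have [m /= ms mmax] := IH b' (mem_head _ _).
have [bm|mb] := leP (f b) (f m).
  exists m => /= [|j]; first by rewrite inE ms orbT.
  by rewrite inE => /predU1P[->|/mmax].
exists b => /= [|j]; first exact: mem_head.
by rewrite inE => /predU1P[->//|/mmax jm]; rewrite (le_trans jm) // ltW.
Qed.

(** The rank is the position in the sorted list of heights attained on A, so no level from 0 to K is
    empty. Outside A it may be the default K + 1 of [index]. *)
Lemma finite_rank (A : set int) (h : int -> int) a : finite_set A -> A a ->
  exists (rk : int -> nat) (K : nat),
    [/\ forall i j, A i -> A j -> h i < h j -> (rk i < rk j)%N,
        forall i j, h i = h j -> rk i = rk j,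
        forall l, (l <= K)%N -> exists2 i, A i & rk i = l,
        forall i, A i -> (rk i <= K)%N &
        (K < #|` fset_set A|)%N].
Proof.
move=> Af Aa; pose V := sort <=%O (undup [seq h i | i <- fset_set A]).
have VP v : v \in V -> exists2 i, A i & h i = v.
  rewrite mem_sort mem_undup => /mapP[i iA ->]; exists i => //.
  by move: iA; rewrite in_fset_set ?inE.
have AV i : A i -> h i \in V.
  by move=> Ai; rewrite mem_sort mem_undup map_f // in_fset_set ?inE.
have Vs : sorted <%O V by rewrite lt_sorted_uniq_le sort_uniq undup_uniq sort_le_sorted.
have V0 : (0 < size V)%N by have := AV _ Aa; rewrite -index_mem; exact: leq_ltn_trans.
exists (fun i => index (h i) V), (size V).-1; split.
- move=> i j Ai Aj hij; rewrite ltnNge leq_eqVlt; apply/negP => /orP[/eqP ji|ji].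
    have := congr1 (nth 0 V) ji; rewrite !nth_index ?AV // => hji.
    by rewrite hji ltxx in hij.
  have := sorted_ltn_index lt_trans Vs _ _ (AV _ Aj) (AV _ Ai) ji.
  by move=> hji; have := lt_trans hij hji; rewrite ltxx.
- by move=> i j ->.
- move=> l lK; have lV : (l < size V)%N by lia.
  have [i Ai hi] := VP _ (mem_nth 0 lV); exists i => //.
  by rewrite hi index_uniq // sort_uniq undup_uniq.
- by move=> i Ai; rewrite -ltnS prednK // index_mem AV.
rewrite prednK // size_sort; apply: leq_trans (size_undup _) _.
by rewrite size_map.
Qed.

(** * Blocks of a tubing and a height adapted to them *)

Section Blocks.
Variables (n : nat) (P : affinePoset n).
Hypothesis n_gt0 : (0 < n)%N.
Local Notation N := (n%:Z).
Local Notation msize t := #|` fset_set t|.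
Implicit Types (s t : set int) (T : set (set int)).
Variable T : set (set int).
Hypothesis T_tub : proper_tubing P T.

Lemma tubing_proper t : T t -> proper_tube P t.
Proof. by case: T_tub => H _ _ _; exact: H. Qed.

Lemma tubing_shift t k : T (shift_tube n t k) <-> T t.
Proof.
case: T_tub => _ H _ _; split=> [Tt|]; last by move/H.
by have := H _ Tt (- k); rewrite shift_tubeD subrr shift_tube0.
Qed.

Lemma tubing_nested s t e : T s -> T t -> s e -> t e -> nested s t.
Proof.
move=> Ts Tt se te; case: T_tub => _ _ /(_ _ _ Ts Tt) [//|st] _.
by have : (s `&` t) e by []; rewrite st.
Qed.

Definition maximal_tube t := T t /\ forall s, T s -> t `<=` s -> s `<=` t.

Lemma maximal_tube_ex t : T t -> exists2 s, maximal_tube s & t `<=` s.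
Proof.
have [k] := ubnP (n - msize t)%N; elim: k t => // k IH t tk Tt.
have [tm|] := pselect (maximal_tube t); first by exists t.
move=> /not_andP[//|/existsNP [s /not_implyP [Ts /not_implyP [ts /existsNP [i /not_implyP
  [si nti]]]]]].
have sp := tubing_proper Ts.
have lt_ts := card_fset_proper (proper_tube_finite n_gt0 sp) ts si nti.
have /andP[_ sn] := proper_tube_size n_gt0 sp.
have [|r rm sr] := IH s _ Ts; first by lia.
by exists r => // j /ts /sr.
Qed.

Lemma maximal_tube_eq s t e : maximal_tube s -> maximal_tube t -> s e -> t e -> s = t.
Proof.
move=> [Ts sm] [Tt tm] se te; have [st|ts] := tubing_nested Ts Tt se te.
  by apply/seteqP; split => //; apply: sm.
by apply/seteqP; split => //; apply: tm.
Qed.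

Lemma maximal_tube_shift t k : maximal_tube t -> maximal_tube (shift_tube n t k).
Proof.
move=> [Tt tm]; split; first exact/tubing_shift.
move=> s Ts ts i si; apply/shift_tubeP.
have := tm (shift_tube n s (- k)) ((tubing_shift _ _).2 Ts); apply.
  move=> j tj; apply/shift_tubeP; apply: ts; apply/shift_tubeP.
  by rewrite mulNr opprK addrK.
by apply/shift_tubeP; rewrite mulNr opprK subrK.
Qed.

(** The classes are the maximal tubes and the singletons outside all tubes. *)
Definition same_block i j := i = j \/ exists t, [/\ T t, t i & t j].

Lemma same_block_refl i : same_block i i. Proof. by left. Qed.

Lemma same_block_sym i j : same_block i j -> same_block j i.
Proof. by case=> [->|[t [Tt ti tj]]]; [left|right; exists t]. Qed.

Lemma same_block_trans i j k : same_block i j -> same_block j k -> same_block i k.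
Proof.
case=> [->//|[t [Tt ti tj]]] [<-|[s [Ts sj sk]]]; first by right; exists t.
by right; have [ts|st] := tubing_nested Tt Ts tj sj;
  [exists s; split => //; exact: ts|exists t; split => //; exact: st].
Qed.

Lemma same_block_shift i j k : same_block (i + k * N) (j + k * N) <-> same_block i j.
Proof.
split=> -[ij|[t [Tt ti tj]]].
- by left; exact: addIr ij.
- right; exists (shift_tube n t (- k)); split; first exact/tubing_shift.
    by apply/shift_tubeP; rewrite mulNr opprK.
  by apply/shift_tubeP; rewrite mulNr opprK.
- by left; rewrite ij.
- right; exists (shift_tube n t k); split; first exact/tubing_shift.
    by exists i.
  by exists j.
Qed.

Lemma same_block_residue i j : same_block i j -> (i = j %[mod n])%Z -> i = j.
Proof.
by case=> // -[t [/tubing_proper tp ti tj]]; exact: proper_tube_inj tp ti tj.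
Qed.

Lemma same_block_maximal i j t : maximal_tube t -> t i -> same_block i j -> t j.
Proof.
move=> [Tt tm] ti [<-//|[s [Ts si sj]]].
by have [ts|st] := tubing_nested Tt Ts ti si; [exact: tm sj|exact: st].
Qed.

Lemma same_block_finite i : finite_set [set j | same_block i j].
Proof.
have [[t [Tt ti]]|nt] := pselect (exists t, T t /\ t i).
  have [s sm ts] := maximal_tube_ex Tt.
  apply: (@sub_finite_set _ _ s); last by apply: (proper_tube_finite n_gt0);
    apply/tubing_proper; case: sm.
  by move=> j /=; apply: same_block_maximal => //; exact: ts.
apply: (@sub_finite_set _ _ [set i]) => // j [<-//|[t [Tt ti _]]].
by case: nt; exists t.
Qed.

(** Otherwise connectedness confines s to one block; having two elements, s then lies in a maximal
    tube. *)
Lemma cross_edge s : proper_tube P s -> (forall t, T t -> ~ s `<=` t) ->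
  exists i j, [/\ s i, s j, covered P i j & ~ same_block i j].
Proof.
move=> sp ns; apply: contrapT => nex.
have sb i j : s i -> s j -> covered P i j -> same_block i j.
  by move=> si sj ij; apply: contrapT => nb; apply: nex; exists i, j.
have [e se] := proper_tube_neq0 n_gt0 sp.
have all j : s j -> same_block e j.
  move=> sj; case: sp => -[sc _ _ _] _;
    elim: (sc _ _ se sj) => [u v [su sv [uv|vu]]|u|u v w _ uv _ vw].
  - exact: sb.
  - by apply: same_block_sym; exact: sb.
  - exact: same_block_refl.
  - exact: same_block_trans uv vw.
have [a [b [sa sb' ab]]] := card_ge2P (proper_tube_finite n_gt0 sp) (proj1 (andP
  (proper_tube_size n_gt0 sp))).
have [t Tt te] : exists2 t, T t & t e.
  have [ea|[t [Tt te _]]] := all a sa; last by exists t.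
  have [eb|[t [Tt te _]]] := all b sb'; last by exists t.
  by case: ab; rewrite -ea -eb.
have [r rm tr] := maximal_tube_ex Tt.
apply: (ns r); first by case: rm.
by move=> j /all; apply: same_block_maximal => //; exact: tr.
Qed.

(** Indexed like the acyclicity clause of [proper_tubing], to which a chain is handed directly. *)
Definition tube_chain s t := exists m (f : nat -> set int),
  [/\ f 0 = s, f m = t, forall l, (l <= m)%N -> maximal_tube (f l) &
      forall l, (l < m)%N -> tube_lt P (f l) (f l.+1)].

Lemma tube_chain_refl s : maximal_tube s -> tube_chain s s.
Proof. by move=> sm; exists 0%N, (fun=> s); split. Qed.

Lemma tube_chain_step s t : maximal_tube s -> maximal_tube t -> tube_lt P s t -> tube_chain s t.
Proof.
move=> sm tm st; exists 1%N, (fun l => if l is 0 then s else t); split=> //.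
  by case.
by case.
Qed.

Lemma tube_chain_trans s t r : tube_chain s t -> tube_chain t r -> tube_chain s r.
Proof.
move=> [m [f [f0 fm fM f_lt]]] [m' [g [g0 gm gM g_lt]]].
exists (m + m')%N, (fun l => if (l <= m)%N then f l else g (l - m)%N); split=> //=.
- have [mm|mm] := leqP (m + m') m; last by rewrite addKn.
  have m'0 : m' = 0%N by lia.
  by rewrite m'0 addn0 fm -gm m'0.
- move=> l lm; case: ifP => [/fM//|lm']; apply: gM; lia.
move=> l lm; case: (ltngtP l m) => ml.
- exact: f_lt.
- by rewrite (_ : (l.+1 - m)%N = (l - m).+1); [apply: g_lt; lia|lia].
- rewrite ml subSnn fm -g0; apply: g_lt; lia.
Qed.

Lemma tube_lt_shift s t k : tube_lt P s t -> tube_lt P (shift_tube n s k) (shift_tube n t k).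
Proof.
move=> [st [a [b [sa tb ab]]]]; split; last first.
  by exists (a + k * N), (b + k * N); rewrite alt_shiftk; split => //; [exists a|exists b].
apply/seteqP; split=> // i [/shift_tubeP si /shift_tubeP ti].
by have : (s `&` t) (i - k * N) by []; rewrite st.
Qed.

Lemma tube_chain_shift s t k : tube_chain s t ->
  tube_chain (shift_tube n s k) (shift_tube n t k).
Proof.
move=> [m [f [<- <- fM f_lt]]]; exists m, (fun l => shift_tube n (f l) k); split=> //.
  by move=> l /fM; exact: maximal_tube_shift.
by move=> l /f_lt; exact: tube_lt_shift.
Qed.

(* The order induced on the blocks by P and the relation between tubes; the
   acyclicity of [T] makes it antisymmetric up to [same_block]. *)
Definition block_le i j := ale P i j \/
  exists s t, tube_chain s t /\ exists a b, [/\ s a, t b, ale P i a & ale P b j].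

Lemma chain_maximal s t : tube_chain s t -> maximal_tube s /\ maximal_tube t.
Proof. by move=> [m [f [<- <- fM _]]]; split; apply: fM. Qed.

(** The last tube of the first chain and the first tube of the second are maximal, so they coincide
    or are disjoint; if disjoint, b below j below a' makes them consecutive. *)
Lemma block_le_trans i j k : block_le i j -> block_le j k -> block_le i k.
Proof.
case=> [ij|[s [t [st [a [b [sa tb ia bj]]]]]]] [jk|[s' [t' [st' [a' [b' [sa' tb' ja' bk']]]]]]].
- by left; exact: ale_trans jk.
- by right; exists s', t'; split => //; exists a', b'; split => //; exact: ale_trans ja'.
- by right; exists s, t; split => //; exists a, b; split => //; exact: ale_trans jk.
right; exists s, t'; split; last by exists a, b'.
have [_ tm] := chain_maximal st; have [sm' _] := chain_maximal st'.
have [[e [te se']]|nd] := pselect (exists e, t e /\ s' e).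
  by apply: tube_chain_trans st _; rewrite (maximal_tube_eq tm sm' te se').
apply: tube_chain_trans st (tube_chain_trans (tube_chain_step tm sm' _) st'); split.
  by apply/seteqP; split => // e [te se']; apply: nd; exists e.
exists b, a'; split => //; rewrite /alt (ale_trans bj ja') andbT.
by apply/eqP => ba; apply: nd; exists b; split => //; rewrite ba.
Qed.

(** A chain from s to t leading back from j to i would give b <= i < j <= a with b in t and a in s.
    If s = t, convexity puts i and j in one tube; otherwise t precedes s and closes a forbidden
    cycle. *)
Lemma block_le_strict i j : alt P i j -> ~ same_block i j -> ~ block_le j i.
Proof.
move=> ij nb [ji|[s [t [st [a [b [sa tb ja bi]]]]]]].
  by have /negP := alt_nge ij.
have [sm tm] := chain_maximal st.
have ba : alt P b a by apply: le_alt_trans bi (alt_le_trans ij ja).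
have [[e [se te]]|nd] := pselect (exists e, s e /\ t e).
  have E := maximal_tube_eq sm tm se te; subst t.
  have [[_ sv _ _] _] := tubing_proper (proj1 sm).
  apply: nb; right; exists s; split; first by case: sm.
    by apply: sv tb sa bi (altW (alt_le_trans ij ja)).
  by apply: sv tb sa (ale_trans bi (altW ij)) ja.
have ts : tube_lt P t s.
  split; last by exists b, a.
  by apply/seteqP; split => // e [te se]; apply: nd; exists e.
case: st => m [f [f0 fm fM f_lt]]; case: T_tub => _ _ _ /(_ m f); rewrite f0 fm; apply => //.
by move=> l /fM [].
Qed.

Lemma same_block_le i j : same_block i j -> block_le i j.
Proof.
case=> [->|[t [Tt ti tj]]]; first by left; exact: ale_refl.
have [s sm ts] := maximal_tube_ex Tt; right; exists s, s; split; first exact: tube_chain_refl.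
by exists i, j; rewrite !ale_refl; split => //; exact: ts.
Qed.

(** The last clause doubles the gap below a block with several elements: in [realize_final] such a
    block hangs below its maximum and needs that room. *)
Lemma exists_block_height : exists h : int -> int,
  [/\ forall i, h (i + N) = h i + N,
      forall i j, same_block i j -> h i = h j,
      forall i j, alt P i j -> ~ same_block i j -> h i + 1 <= h j &
      forall i j j', alt P i j -> ~ same_block i j -> same_block j j' -> j <> j' ->
        h i + 2 <= h j].
Proof.
have [||||||h [hN hm hs hs2]] := @exists_height n n_gt0 block_le.
- by move=> i; left; exact: ale_refl.
- exact: block_le_trans.
- move=> i j k [ij|[s [t [st [a [b [sa tb ia bj]]]]]]]; first by left; rewrite ale_shiftk.
  right; exists (shift_tube n s k), (shift_tube n t k); split; first exact: tube_chain_shift.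
  exists (a + k * N), (b + k * N); rewrite !ale_shiftk; split => //; by [exists a|exists b].
- by move=> i; left; exact: ale_addn.
- by move=> i j; have [k ik] := ale_cofinal P i j; exists k; left.
- move=> i k ik; rewrite leNgt; apply/negP => k0.
  apply: block_le_strict ik.
    rewrite /alt; apply/andP; split; first by apply/eqP => E; nia.
    by rewrite -(ale_shiftk P (- k)) mulNr addrK -mulNr ale_up //; lia.
  move/same_block_residue => H; have : i + k * N = i by apply: H; rewrite addrC modzMDl.
  nia.
exists h; split => //.
- by move=> i j ij; apply/eqP; rewrite eq_le !hm //; apply: same_block_le => //;
  exact: same_block_sym.
- by move=> i j ij nb; apply: hs; [left; exact: altW|exact: block_le_strict].
move=> i j j' ij nb jj' ne; apply: (hs2 _ _ j').
- by left; exact: altW.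
- exact: block_le_strict.
- exact: same_block_le.
- by apply: same_block_le; exact: same_block_sym.
by apply/eqP => /(same_block_residue jj').
Qed.

End Blocks.

Section BlockMaximum.
Variables (R : realType) (n : nat) (P : affinePoset n) (T : set (set int)).
Hypothesis n_gt0 : (0 < n)%N.
Hypothesis T_tub : proper_tubing P T.
Variable u : int -> R.
Local Notation N := (n%:Z).
Hypothesis u_per : forall i, u (i + N) = u i.
Local Notation blk := (same_block T).

Lemma u_perk i k : u (i + k * N) = u i.
Proof.
have H (m : nat) j : u (j + m%:Z * N) = u j.
  elim: m j => [|m IH] j; first by rewrite mul0r addr0.
  by rewrite intS mulrDl mul1r addrA IH u_per.
case: k => m; first exact: H.
by rewrite -(H m.+1) NegzE -addrA -mulrDl addNr mul0r addr0.
Qed.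

Lemma block_max : exists M : int -> R,
  [/\ forall i, exists2 j, blk i j & M i = u j,
      forall i j, blk i j -> u j <= M i,
      forall i j, blk i j -> M i = M j &
      forall i, M (i + N) = M i].
Proof.
have ex i : exists2 m, blk i m & forall j, blk i j -> u j <= u m.
  by apply: (@finite_argmax _ _ _ i (same_block_finite n_gt0 T_tub i)); left.
pose g i := s2val (cid2 (ex i)).
have gb i : blk i (g i) by rewrite /g; case: cid2.
have gm i j : blk i j -> u j <= u (g i) by rewrite /g; case: cid2 => /= m _; apply.
have gle i j : blk i j -> u (g j) <= u (g i).
  by move=> ij; apply: gm; exact: (same_block_trans T_tub ij (gb j)).
have geq i j : blk i j -> u (g i) = u (g j).
  by move=> ij; apply/eqP; rewrite eq_le !gle //; exact: same_block_sym.
exists (fun i => u (g i)); split.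
- by move=> i; exists (g i).
- exact: gm.
- exact: geq.
move=> i; apply/eqP; rewrite eq_le; apply/andP; split.
  have := (same_block_shift T_tub (i + N) (g (i + N)) (-1)).2 (gb (i + N)).
  by rewrite mulN1r addrK => /gm; rewrite -mulN1r u_perk.
have := (same_block_shift T_tub i (g i) 1).2 (gb i).
by rewrite mul1r => /gm; rewrite u_per.
Qed.

End BlockMaximum.

(** Here [m] is the size of a tube, [b], [e1], [e2] are the bounds for sizes m, m - 1, m - 2, [D] is
    the total extent of its levels, [a] and [l] are alpha of the stacked levels and of the ranks,
    [k] is the top rank and [s] the spacing. Stacking uses at most half of [b], so s l >= b/2; since
    l <= m(m-1)k/2 and m(m-1) < n^2, this yields e1 < s k, and then k <= m - 1 yields e2 < s. *)
Lemma step_bounds (R : realType) (n m k e2 e1 b D a l s : R) :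
  2 <= m -> m <= n -> 1 <= k -> k <= m - 1 -> 0 < e2 ->
  e1 = n * n * e2 -> b = n * n * e1 -> (m - 1) * D <= e1 * m ->
  2 * a <= m * (m - 1) * D -> 1 <= l -> 2 * l <= m * (m - 1) * k -> s * l = b - a ->
  [/\ 0 < s, e1 < s * k & e2 < s].
Proof.
move=> m2 mn k1 km e20 e1E bE DB aB l1 lB sl.
set q := m * (m - 1) in aB lB.
have q0 : 0 < q by rewrite mulr_gt0; lra.
have n0 : 0 < n by lra.
have qn : q < n * n.
  apply: (@lt_le_trans _ _ (m * m)); last by rewrite ler_pM; lra.
  by rewrite ltr_pM2l; lra.
have nn0 : 0 < n * n by rewrite mulr_gt0.
have e10 : 0 < e1 by rewrite e1E mulr_gt0.
have b0 : 0 < b by rewrite bE mulr_gt0.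
have ab : 2 * a <= b.
  apply: le_trans aB _; rewrite /q -mulrA; apply: (@le_trans _ _ (m * (e1 * m))).
    by rewrite ler_wpM2l //; lra.
  rewrite bE [e1 * m]mulrC mulrA ler_wpM2r ?(ltW e10) //.
  by apply: ler_pM => //; lra.
have s0 : 0 < s.
  by rewrite -(pmulr_lgt0 s (_ : 0 < l)) ?sl; [lra|lra].
have sq : b <= s * k * q.
  have := ler_wpM2l (ltW s0) lB; rewrite mulrCA sl -mulrA [k * q]mulrC.
  by move: ab; clear; move: (s * _) => v; lra.
split=> //; rewrite ltNge; apply/negP => H.
  have := ler_wpM2r (ltW q0) H.
  have : e1 * q < e1 * (n * n) by rewrite ltr_pM2l.
  by move: sq; rewrite bE [_ * e1]mulrC; clear; lra.
have H1 : s * k <= e2 * (m - 1) by apply: ler_pM => //; [exact: ltW|lra].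
have := ler_wpM2r (ltW q0) H1.
have mnn : m - 1 < n * n.
  apply: (@lt_le_trans _ _ n); first by lra.
  by rewrite ler_peMr //; lra.
have : e2 * (m - 1) * q < e2 * (n * n) * (n * n).
  apply: ltr_pM => //; [by rewrite mulr_ge0 ?ltW //; lra|exact: ltW|by rewrite ltr_pM2l].
have -> : e2 * (n * n) * (n * n) = b by rewrite bE e1E; ring.
by move: sq; clear; lra.
Qed.

Lemma spread_bound (R : realType) (n m e1 H : R) : 2 <= m -> m <= n -> 0 < e1 ->
  2 * (n * n * e1) <= m * (m - 1) * H -> 2 * e1 < H.
Proof.
move=> m2 mn e10 Hq; rewrite ltNge; apply/negP => He.
have q0 : 0 < m * (m - 1) by rewrite mulr_gt0; lra.
have qn : m * (m - 1) < n * n.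
  apply: (@lt_le_trans _ _ (m * m)); last by rewrite ler_pM; lra.
  by rewrite ltr_pM2l; lra.
have := ler_wpM2l (ltW q0) He.
have : e1 * (m * (m - 1)) < e1 * (n * n) by rewrite ltr_pM2l.
move: Hq; rewrite [n * n * e1]mulrC; move: (m * (m - 1)) (n * n) => q v; clear.
lra.
Qed.

(** * Placing the blocks, and laying out a single tube *)

Section Realizing.
Variables (R : realType) (n : nat) (P : affinePoset n).
Hypothesis n_gt0 : (0 < n)%N.
Local Notation N := (n%:Z).
Local Notation msize t := #|` fset_set t|.
Local Notation bound t := ((n ^ (2 * msize t))%:R : R).
Implicit Types (s t : set int) (T : set (set int)) (u : int -> R^o).

Definition realizes_on T u t := forall s, proper_tube P s -> s `<=` t ->
  (T s -> alpha_seq P s u = bound s) /\ (~ T s -> bound s < alpha_seq P s u).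

Lemma realizes_ge T u t s : realizes_on T u t -> proper_tube P s -> s `<=` t ->
  bound s <= alpha_seq P s u.
Proof.
move=> H sp st; have [H1 H2] := H _ sp st.
by have [/H1->|/H2/ltW] := pselect (T s).
Qed.

Lemma realizes_edge T u t i j : proper_tube P t -> realizes_on T u t -> t i -> t j ->
  covered P i j -> u i < u j.
Proof.
move=> tp H ti tj ij; have ijp : proper_tube P [set i; j].
  apply: (cover_tube n_gt0 ij) => E; apply: (covered_irr ij).
  exact: proper_tube_inj tp ti tj E.
have sub : [set i; j] `<=` t by move=> _ [->|->].
have := realizes_ge H ijp sub; rewrite alpha_seq_edge // => H1.
by rewrite -subr_gt0; apply: lt_le_trans H1; rewrite ltr0n expn_gt0 n_gt0.
Qed.

Lemma realizes_nondec T u t : proper_tube P t -> realizes_on T u t -> nondec_on P t u.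
Proof. by move=> tp H a b ta tb ab; apply/ltW/(realizes_edge tp H). Qed.

Variable T : set (set int).
Hypothesis T_tub : proper_tubing P T.
Variable u : int -> R^o.
Hypothesis u_per : forall i, u (i + N) = u i.
Hypothesis u_real : forall t, T t -> realizes_on T u t.

Local Notation blk := (same_block T).

Lemma tube_spread t i j : T t -> t i -> t j -> u i - u j <= bound t.
Proof.
move=> Tt ti tj; have tp := tubing_proper T_tub Tt.
rewrite -((u_real Tt tp (@subset_refl _ t)).1 Tt).
apply: le_trans (ler_norm _) _; apply: (alpha_seq_diam _ _ _ tj ti).
- exact: (proper_tube_finite n_gt0 tp).
- by case: tp => -[].
- exact: realizes_nondec tp (u_real Tt).
Qed.

Lemma block_edge i j : blk i j -> covered P i j -> u i < u j.
Proof.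
case=> [->|[t [Tt ti tj]]] ij; first by have := covered_irr ij.
exact: (realizes_edge (tubing_proper T_tub Tt) (u_real Tt)).
Qed.

(* Each block keeps its shape and is pinned at its maximum, blocks being
   separated by multiples of [c / n]. *)
Lemma realize_final : exists2 x : int -> R^o, period_seq n x &
  forall s, proper_tube P s ->
    (T s -> alpha_seq P s x = bound s) /\ (~ T s -> bound s < alpha_seq P s x).
Proof.
have [M [M_ex M_ub M_eq M_per]] := block_max n_gt0 T_tub u_per.
have [h [hN h_eq h1 h2]] := exists_block_height n_gt0 T_tub.
(* This is c / n: the height grows by n over a period, so [x] grows by n w = c. *)
pose w : R := (n ^ (2 * n).+1)%:R.
have w0 : 0 <= w by rewrite ler0n.
pose x : int -> R^o := fun i => (u i - M i) + (h i)%:~R * w.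
have x_blk i j : blk i j -> x j - x i = u j - u i.
  by move=> ij; rewrite /x (M_eq _ _ ij) (h_eq _ _ ij); ring.
(* In a block with several elements, j lies at most v = n^(2n) below the block maximum, and 2w - v >
   v since w >= 2v. A block reduced to j sits at its maximum, so a gap of w is enough. *)
have gap i j : (2 <= n)%N -> alt P i j -> ~ blk i j -> (n ^ (2 * n))%:R < x j - x i.
  move=> n2 ij nb; have wE : w = n%:R * (n ^ (2 * n))%:R by rewrite /w expnS natrM.
  set v : R := (n ^ (2 * n))%:R in wE *.
  have v0 : 0 < v by rewrite ltr0n expn_gt0 n_gt0.
  have wv : 2 * v <= w by rewrite wE ler_pM2r // ler_nat.
  have uM := M_ub i i (same_block_refl T i).
  have xE : x j - x i = (u j - M j) + (M i - u i) + (h j - h i)%:~R * w.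
    by rewrite /x intrB; ring.
  have [[j' [jj' ne]]|nj] := pselect (exists j', blk j j' /\ j <> j').
    have hh : (2 : R) <= (h j - h i)%:~R.
      by rewrite (_ : 2 = 2%:~R) // ler_int lerBrDl; exact: h2 jj' ne.
    have uMj : M j - u j <= v.
      have [l jl ->] := M_ex j; case: jl => [->|[t [Tt tj tl]]]; first by rewrite subrr ltW.
      apply: le_trans (tube_spread Tt tl tj) _; rewrite ler_nat leq_exp2l //.
      by have /andP[] := proper_tube_size n_gt0 (tubing_proper T_tub Tt); lia.
    have := ler_wpM2r w0 hh; rewrite xE; lra.
  have hh : (1 : R) <= (h j - h i)%:~R.
    by rewrite (_ : 1 = 1%:~R) // ler_int lerBrDl; exact: h1.
  have uMj : M j = u j.
    by have [l jl ->] := M_ex j; congr u; apply: contrapT => lj; apply: nj; exists l;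
      split=> //; move/esym.
  have := ler_wpM2r w0 hh; rewrite xE uMj; lra.
exists x.
  move=> i; rewrite /x u_per M_per hN intrD mulrDl addrA; congr (_ + _).
  by rewrite /w -natrM -expnS; congr ((_ ^ _)%:R); lia.
move=> s sp; have n2 := proper_tube_n2 n_gt0 sp.
have [[t [Tt st]]|nt] := pselect (exists t, T t /\ s `<=` t).
  rewrite (@alpha_seq_ext _ _ _ s x u); first exact: u_real Tt _ sp st.
  by move=> a b /st ta /st tb; apply: x_blk; right; exists t.
have nT : ~ T s by move=> Ts; apply: nt; exists s; split.
split=> // _; have [i [j [si sj ij nb]]] := cross_edge n_gt0 T_tub sp (fun t Tt st =>
  nt (ex_intro _ t (conj Tt st))).
have sn : bound s <= (n ^ (2 * n))%:R.
  by rewrite ler_nat leq_exp2l //; have /andP[] := proper_tube_size n_gt0 sp; lia.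
apply: le_lt_trans sn _; apply: lt_le_trans (gap i j n2 (proj1 ij) nb) _.
apply: le_trans (ler_norm _) _; apply: alpha_seq_diam si sj.
- exact: (proper_tube_finite n_gt0 sp).
- by case: sp => -[].
move=> a b _ _ ab; rewrite -subr_ge0; have [bab|nab] := pselect (blk a b).
  by rewrite (x_blk _ _ bab) subr_ge0 ltW // block_edge.
by apply: ltW; apply: lt_trans (gap a b n2 (proj1 ab) nab); rewrite ltr0n expn_gt0 n_gt0.
Qed.

Section Layout.
Variable t0 : set int.
Hypothesis t0_tube : proper_tube P t0.
Hypothesis t0_sub : forall t e, T t -> t e -> t0 e -> t `<=` t0.
Hypothesis t0_nsub : forall t, T t -> ~ t0 `<=` t.

(** As n^(2a)/a does not decrease with a, the extents of small levels are bounded in proportion to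
    their sizes, and such bounds can be summed. *)
Lemma pow_ratio a b : (2 <= n)%N -> (0 < a <= b)%N ->
  (n ^ (2 * a) * b <= n ^ (2 * b) * a)%N.
Proof.
move=> n2 /andP[a0 ab]; rewrite -(subnKC ab); elim: (b - a)%N => [|d IH];
  first by rewrite addn0.
rewrite addnS [(2 * _.+1)%N]mulnS expnD -mulnA.
apply: (@leq_trans (4 * (n ^ (2 * a) * (a + d)))); first by nia.
by apply: leq_mul => //; rewrite (@leq_exp2r 2 n 2).
Qed.

Lemma level_sum (rk : int -> nat) (K : nat) :
  (\sum_(l < K) msize [set i | t0 i /\ rk i = l] <= msize t0)%N.
Proof.
have tf := proper_tube_finite n_gt0 t0_tube.
have lev (l : nat) : msize [set i | t0 i /\ rk i = l] = (\sum_(i <- fset_set t0) (rk i == l))%N.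
  rewrite -sum1_size -big_mkcond -[RHS]big_filter.
  have lf : finite_set [set i | t0 i /\ rk i = l] by apply: sub_finite_set tf => i [].
  apply: perm_big; apply: uniq_perm; rewrite ?filter_uniq ?fset_uniq // => i.
  rewrite mem_filter !in_fset_set //; apply/idP/andP; rewrite !inE.
    by move=> [ti ->].
  by move=> [/eqP ri ti].
under eq_bigr => l _ do rewrite lev.
rewrite exchange_big /= -[leqRHS]sum1_size; apply: leq_sum => i _.
have [rK|rK] := ltnP (rk i) K.
  rewrite (bigD1 (Ordinal rK)) //= eqxx big1 // => l lr.
  by apply/eqP; rewrite eqb0; apply: contra lr => /eqP rl; apply/eqP/val_inj.
by rewrite big1 // => l _; apply/eqP; rewrite eqb0; have := ltn_ord l; lia.
Qed.

(* The levels of the height function, each of vertical extent [D l], are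
   stacked at distance [s], where [s] makes the inequality of [t0] tight.
   A subtube with at most [m - 2] elements contains an edge of length at least
   [s]; one with [m - 1] elements spreads over almost the whole height. *)
Lemma exists_layout : exists y : int -> R^o,
  [/\ forall i j, t0 i -> t0 j -> blk i j -> y j - y i = u j - u i,
      alpha_seq P t0 y = bound t0 &
      forall s, proper_tube P s -> s `<=` t0 -> s <> t0 ->
        (forall t, T t -> ~ s `<=` t) -> bound s < alpha_seq P s y].
Proof.
have tf := proper_tube_finite n_gt0 t0_tube.
have n2 := proper_tube_n2 n_gt0 t0_tube.
have /andP[m2 mn] := proper_tube_size n_gt0 t0_tube.
have [a0 t0a] := proper_tube_neq0 n_gt0 t0_tube.
set m := msize t0 in m2 mn *.
have [h [_ h_eq h1 _]] := exists_block_height n_gt0 T_tub.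
have [rk [K [rk_lt rk_eq rk_ex rk_le Km]]] := finite_rank h tf t0a.
(* Applied to -u, so that M is minus the block minimum and [xh] is the height above the lowest
   element of the block. *)
have [M [M_ex M_ub M_eq _]] := @block_max R n P T n_gt0 T_tub (fun i => - u i) (fun i =>
  congr1 -%R (u_per i)).
pose xh i : R := u i + M i.
have xh0 i : 0 <= xh i by have := M_ub i i (same_block_refl T i); rewrite /xh; lra.
have xh_blk i j : blk i j -> xh j - xh i = u j - u i.
  by move=> ij; rewrite /xh (M_eq _ _ ij); ring.
have blk_in i j : blk i j -> t0 i -> t0 j.
  by move=> [<-//|[t [Tt ti tj]]] t0i; exact: t0_sub Tt ti t0i _ tj.
have blk_rk i j : blk i j -> rk i = rk j by move=> /h_eq /rk_eq.
have xh_min i : t0 i -> exists j, [/\ t0 j, rk j = rk i & xh j = 0].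
  move=> ti; have [j ij Mi] := M_ex i; exists j; split; first exact: blk_in ij ti.
    by rewrite (blk_rk _ _ ij).
  by rewrite /xh -(M_eq _ _ ij) Mi subrr.
pose lev (l : nat) := [set i | t0 i /\ rk i = l].
have levf l : finite_set (lev l) by apply: sub_finite_set tf => i [].
have xh_ub i : t0 i -> xh i <= bound (lev (rk i)).
  move=> ti; have [j ij Mi] := M_ex i; rewrite /xh Mi.
  case: (ij) => [<-|[t [Tt t_i t_j]]]; first by rewrite subrr ler0n.
  apply: le_trans (tube_spread Tt t_i t_j) _; rewrite ler_nat leq_pexp2l // leq_mul2l.
  apply/orP; right; apply: card_fset_sub => // k tk; split.
    exact: t0_sub Tt t_i ti _ tk.
  by apply/esym/blk_rk; right; exists t.
have D_ex l : exists d, [/\ 0 <= d, forall i, t0 i -> rk i = l -> xh i <= d &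
    (l <= K)%N -> exists2 i, lev l i & d = xh i].
  have [lK|lK] := leqP l K; last first.
    by exists 0; split=> // i ti ri; have := rk_le _ ti; lia.
  have [i ti ri] := rk_ex _ lK; have [k kl kmax] := finite_argmax xh (levf l) (conj ti ri).
  by exists (xh k); split=> [|j tj rj|_] //; [exact: kmax|exists k].
pose D l := sval (cid (D_ex l)).
have DP l : [/\ 0 <= D l, forall i, t0 i -> rk i = l -> xh i <= D l &
    (l <= K)%N -> exists2 i, lev l i & D l = xh i] by exact: svalP (cid (D_ex l)).
pose S l := \sum_(k < l) D k.
have SS l : S l.+1 = S l + D l by rewrite /S big_ord_recr.
have S_mono k l : (k <= l)%N -> S k <= S l.
  move=> kl; rewrite -(subnKC kl); elim: (l - k)%N => [|d IH]; first by rewrite addn0.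
  by rewrite addnS SS; case: (DP (k + d)%N) => d0 _ _; lra.
have S0 : S 0%N = 0 by rewrite /S big_ord0.
(* Levels stacked directly on top of each other; the spacing s per rank is added afterwards. *)
pose z i : R^o := xh i + S (rk i).
have z_lt i j : t0 i -> t0 j -> (rk i < rk j)%N -> z i <= z j.
  move=> ti tj ij; have := S_mono _ _ ij; rewrite SS /z.
  by case: (DP (rk i)) => _ /(_ i ti erefl) ? _; have := xh0 j; lra.
have z_ub i : t0 i -> z i <= S K.+1.
  move=> ti; have := S_mono (rk i).+1 K.+1; rewrite ltnS rk_le // => /(_ isT).
  by rewrite SS /z; case: (DP (rk i)) => _ /(_ i ti erefl) ? _; lra.
have z0 i : 0 <= z i.
  by have := S_mono 0%N (rk i) (leq0n _); rewrite S0 /z; have := xh0 i; lra.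
have cov_rk i j : t0 i -> t0 j -> covered P i j -> ~ blk i j -> (rk i < rk j)%N.
  by move=> ti tj ij nb; apply: rk_lt => //; have := h1 _ _ (proj1 ij) nb; lia.
have [i1 [j1 [ti1 tj1 ij1 nb1]]] := cross_edge n_gt0 T_tub t0_tube t0_nsub.
have rij1 := cov_rk _ _ ti1 tj1 ij1 nb1.
have K1 : (1 <= K)%N by have := rk_le _ tj1; lia.
pose e1 : R := (n ^ (2 * (m - 1)))%:R.
pose e2 : R := (n ^ (2 * (m - 2)))%:R.
have e1_gt0 : 0 < e1 by rewrite ltr0n expn_gt0 n_gt0.
have e2_gt0 : 0 < e2 by rewrite ltr0n expn_gt0 n_gt0.
have e1E : e1 = n%:R * n%:R * e2.
  by rewrite /e1 /e2 -!natrM -[(n * n)%N]/(n ^ 2)%N -expnD; congr ((_ ^ _)%:R); lia.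
have bE : bound t0 = n%:R * n%:R * e1.
  by rewrite -/m /e1 -!natrM -[(n * n)%N]/(n ^ 2)%N -expnD; congr ((_ ^ _)%:R); lia.
(* There are at least two levels, so each has at most m - 1 elements; [pow_ratio] bounds its extent
   by e1/(m-1) times its size, and the sizes add up to at most m. *)
have Dtot : (m%:R - 1) * S K.+1 <= e1 * m%:R.
  have lev_lt l : (l <= K)%N -> (0 < msize (lev l) <= m - 1)%N.
    move=> lK; have [i ti ri] := rk_ex _ lK; apply/andP; split.
      rewrite -(card_fset_set1 i); apply: card_fset_sub => // _ ->; split => //.
    have [l' l'K ll'] : exists2 l', (l' <= K)%N & l' <> l.
      by case: l lK {ri} => [|l] lK; [exists 1%N|exists 0%N].
    have [j tj rj] := rk_ex _ l'K.
    have : (msize (lev l) < msize t0)%N; last by rewrite -/m; lia.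
    by apply: (@card_fset_proper _ _ j) => // [k []//|[_]]; rewrite rj.
  have Dl (l : 'I_K.+1) : (m%:R - 1) * D l <= e1 * (msize (lev l))%:R.
    have lK : (l <= K)%N by have := ltn_ord l.
    case: (DP l) => d0 _ /(_ lK) [i [ti ri] ->].
    have := xh_ub _ ti; rewrite ri => H.
    have /andP[l0 lm] := lev_lt _ lK.
    have := @pow_ratio (msize (lev l)) (m - 1) n2; rewrite l0 lm => /(_ isT).
    rewrite -(ler_nat R) !natrM natrB; last by lia.
    rewrite -/e1; apply: le_trans; rewrite mulrC ler_wpM2r // subr_ge0 ler1n; exact: ltnW.
  rewrite mulr_sumr; apply: (@le_trans _ _ (\sum_(l < K.+1) e1 * (msize (lev l))%:R)).
    by apply: ler_sum => l _; exact: Dl.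
  rewrite -mulr_sumr -natr_sum ler_wpM2l ?ler_nat ?ltW //; exact: level_sum.
set Dt := S K.+1 in z_ub Dtot *.
have Dt0 : 0 <= Dt by have := S_mono 0%N K.+1 (leq0n _); rewrite S0.
have az : 2 * alpha_seq P t0 z <= (m%:R * (m%:R - 1)) * Dt.
  apply: alpha_seq_upper => // i j ti tj.
  by have := z0 i; have := z_ub _ tj; clear; lra.
pose rkR i : R^o := (rk i)%:R.
have rk_nd : nondec_on P t0 rkR.
  move=> i j ti tj ij; rewrite ler_nat; have [b|nb] := pselect (blk i j).
    by rewrite (blk_rk _ _ b).
  exact/ltnW/cov_rk.
pose L := alpha_seq P t0 rkR.
have t0c : hasse_connected P t0 by case: t0_tube => -[].
have L1 : 1 <= L.
  apply: (@le_trans _ _ `|rkR j1 - rkR i1|); last by exact: alpha_seq_diam.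
  apply: le_trans (ler_norm _); rewrite /rkR -natrB; last exact: ltnW.
  by rewrite ler1n subn_gt0.
have Lq : 2 * L <= (m%:R * (m%:R - 1)) * K%:R.
  apply: alpha_seq_upper => // i j ti tj; rewrite /rkR.
  apply: (@le_trans _ _ (rk j)%:R); last by rewrite ler_nat rk_le.
  by rewrite gerBl ler0n.
pose s := (bound t0 - alpha_seq P t0 z) / L.
have L0 : 0 < L := lt_le_trans ltr01 L1.
have sL : s * L = bound t0 - alpha_seq P t0 z by rewrite divfK // gt_eqF.
have m2R : (2 : R) <= m%:R by rewrite ler_nat.
have mnR : (m%:R : R) <= n%:R by rewrite ler_nat.
have [s0 sK se2] : [/\ 0 < s, e1 < s * K%:R & e2 < s].
  apply: (step_bounds m2R mnR _ _ e2_gt0 e1E bE Dtot az L1 Lq sL).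
    by rewrite ler1n.
  by rewrite lerBrDr natr1 ler_nat.
pose y i : R^o := s * rkR i + z i.
have ay : alpha_seq P t0 y = bound t0.
  by rewrite /y alpha_seq_lin // -/L sL subrK.
have y_gap i j : t0 i -> t0 j -> (rk i < rk j)%N -> s * ((rk j)%:R - (rk i)%:R) <= y j - y i.
  by move=> ti tj ij; have := z_lt _ _ ti tj ij; rewrite /y /rkR mulrBr; clear; lra.
have y_gap1 i j : t0 i -> t0 j -> (rk i < rk j)%N -> s <= y j - y i.
  move=> ti tj ij; apply: le_trans (y_gap _ _ ti tj ij).
  by apply: ler_peMr; [exact: ltW|rewrite -natrB ?ler1n ?subn_gt0 // ltnW].
have y_blk i j : t0 i -> t0 j -> blk i j -> y j - y i = u j - u i.
  by move=> ti tj ij; rewrite -(xh_blk _ _ ij) /y /z /rkR (blk_rk _ _ ij); ring.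
have y_nd : nondec_on P t0 y.
  move=> i j ti tj ij; rewrite -subr_ge0; have [b|nb] := pselect (blk i j).
    by rewrite y_blk // subr_ge0 ltW // block_edge.
  by apply: le_trans (ltW s0) _; apply: y_gap1 => //; exact: cov_rk.
pose H := Dt + s * K%:R.
have H2 : 2 * e1 < H.
  have : 2 * alpha_seq P t0 y <= (m%:R * (m%:R - 1)) * H.
    apply: alpha_seq_upper => //; first by rewrite /H addr_ge0 // mulr_ge0 ?ler0n // ltW.
    move=> i j ti tj; rewrite /y /H.
    have : s * rkR j <= s * K%:R by rewrite ler_wpM2l ?(ltW s0) // ler_nat rk_le.
    have : 0 <= s * rkR i by apply: mulr_ge0; [exact: ltW|exact: ler0n].
    by have := z0 i; have := z_ub _ tj; clear; lra.
  by rewrite ay bE; exact: spread_bound.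
exists y; split => // r rp rt rne rns.
have rf := proper_tube_finite n_gt0 rp.
have ry i j : r i -> r j -> y j - y i <= alpha_seq P r y.
  move=> ri rj; apply: le_trans (ler_norm _) _; apply: alpha_seq_diam ri rj => //.
    by case: rp => -[].
  by move=> a b /rt ta /rt tb; exact: y_nd.
have [i [j [ri rj ij nb]]] := cross_edge n_gt0 T_tub rp rns.
have rij := cov_rk _ _ (rt _ ri) (rt _ rj) ij nb.
have [v tv nrv] : exists2 v, t0 v & ~ r v.
  apply: contrapT => nv; apply: rne; apply/seteqP; split=> // v tv.
  by apply: contrapT => nrv; apply: nv; exists v.
have [[w [tw nrw wv]]|uniqv] := pselect (exists w, [/\ t0 w, ~ r w & w <> v]).
  apply: (@lt_le_trans _ _ s); last exact: le_trans (y_gap1 _ _ (rt _ ri) (rt _ rj) rij)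
    (ry _ _ ri rj).
  apply: le_lt_trans se2; rewrite ler_nat leq_pexp2l // leq_mul2l; apply/orP; right.
  have r1 : (msize r < msize (r `|` [set w]))%N.
    apply: (@card_fset_proper _ _ w) => //.
    - by rewrite finite_setU; split.
    - by right.
  have : (msize (r `|` [set w]) < msize t0)%N.
    apply: (@card_fset_proper _ _ v) => // [k [/rt//|->//]|[//|/esym//]].
  by move: r1; rewrite -/m; clear; lia.
have r_all k : t0 k -> k <> v -> r k.
  by move=> tk kv; apply: contrapT => nrk; apply: uniqv; exists k.
have r_e1 : bound r <= e1.
  rewrite ler_nat leq_pexp2l // leq_mul2l; apply/orP; right.
  by have := card_fset_proper tf rt tv nrv; rewrite -/m; clear; lia.
apply: (le_lt_trans r_e1).
suff [p [w [rp' rw pw]]] : exists p w, [/\ r p, r w & e1 < y w - y p].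
  exact: lt_le_trans pw (ry _ _ rp' rw).
have rjK := rk_le _ (rt _ rj).
(* With two or more steps, s is at most half of the total height H, and H > 2 e1. *)
have He1 : (2 <= K)%N -> e1 < H - s.
  move=> K2; have : (2 : R) <= K%:R by rewrite ler_nat.
  move=> K2R; have : s * 2 <= s * K%:R by rewrite ler_pM2l.
  by move: H2 Dt0; rewrite /H; clear; lra.
(* If r misses level 0, that level is only v and has extent 0. The bottom of level 1 is then at
   height s and the top of level K at height H. *)
have [[p [rp0 p0]]|np] := pselect (exists p, r p /\ rk p = 0%N); last first.
  have rk_v k : t0 k -> rk k = 0%N -> k = v.
    by move=> tk k0; apply: contrapT => kv; apply: np; exists k; split => //; exact: r_all.
  have ri0 : rk i <> 0%N by move=> i0; apply: np; exists i.
  have K2 : (2 <= K)%N by move: ri0 rij rjK; clear; lia.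
  have [v' tv' v'0] := rk_ex _ (leq0n K).
  have vv := rk_v _ tv' v'0; rewrite vv in v'0 tv'.
  have D0 : D 0%N = 0.
    case: (DP 0%N) => _ _ /(_ (leq0n K)) [k [tk k0] ->].
    have [l [tl lk l0]] := xh_min _ tk.
    by rewrite (rk_v _ tk k0) -(rk_v l tl) // lk.
  have [k tk k1] := rk_ex 1%N K1; have [p [tp pk p0]] := xh_min _ tk.
  rewrite k1 in pk.
  case: (DP K) => _ _ /(_ (leqnn K)) [w [tw wK] Dw].
  exists p, w; split.
  - by apply: r_all => // pv; move: pk; rewrite pv v'0.
  - by apply: r_all => // wv; move: wK K1; rewrite wv v'0; clear; lia.
  have yp : y p = s by rewrite /y /z /rkR pk p0 SS S0 D0 !addr0 mulr1.
  have yw : y w = H by rewrite /y /z /rkR wK -Dw /H /Dt SS; ring.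
  by rewrite yp yw; exact: He1.
have [[w [rw wK]]|nw] := pselect (exists w, r w /\ rk w = K).
  exists p, w; split => //; apply: lt_le_trans sK _.
  have := y_gap _ _ (rt _ rp0) (rt _ rw); rewrite p0 wK subr0; apply; exact: K1.
(* Symmetrically, the top level is only v and has extent 0, so the top of level K - 1 is at height H
   - s, above an element of r at height 0. *)
have rk_v k : t0 k -> rk k = K -> k = v.
  by move=> tk k0; apply: contrapT => kv; apply: nw; exists k; split => //; exact: r_all.
have rjK' : rk j <> K by move=> i0; apply: nw; exists j.
have K2 : (2 <= K)%N by move: rjK' rij rjK; clear; lia.
have [v' tv' v'0] := rk_ex _ (leqnn K).
have vv := rk_v _ tv' v'0; rewrite vv in v'0 tv'.
have DK : D K = 0.
  case: (DP K) => _ _ /(_ (leqnn K)) [k [tk k0] ->].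
  have [l [tl lk l0]] := xh_min _ tk.
  by rewrite (rk_v _ tk k0) -(rk_v l tl) // lk.
have [p' [tp' pk' p'0]] := xh_min _ (rt _ rp0); rewrite p0 in pk'.
have K1' : (K.-1 <= K)%N by exact: leq_pred.
case: (DP K.-1) => _ _ /(_ K1') [w [tw wK] Dw].
exists p', w; split.
- by apply: r_all => // pv; move: pk' K1; rewrite pv v'0; clear; lia.
- by apply: r_all => // wv; move: wK K1; rewrite wv v'0; clear; lia.
have yp : y p' = 0 by rewrite /y /z /rkR pk' p'0 S0 !addr0 mulr0.
have yw : y w = H - s.
  have KE : K = K.-1.+1 by rewrite prednK.
  have SK : Dt = S K.-1 + D K.-1 by rewrite /Dt SS DK addr0 {1}KE SS.
  rewrite /y /z /rkR wK -Dw /H SK.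
  have -> : (K%:R : R) = K.-1%:R + 1 by rewrite natr1 -KE.
  by ring.
by rewrite yp yw subr0; exact: He1.
Qed.

End Layout.

End Realizing.

(** * Induction on the translation classes of tubes *)

Section Existence.
Variables (R : realType) (n : nat) (P : affinePoset n).
Hypothesis n_gt0 : (0 < n)%N.
Local Notation N := (n%:Z).
Local Notation msize t := #|` fset_set t|.
Local Notation bound t := ((n ^ (2 * msize t))%:R : R).
Implicit Types (s t : set int) (T : set (set int)).

Lemma sub_proper_tubing T T' : proper_tubing P T -> T' `<=` T ->
  (forall t k, T' t -> T' (shift_tube n t k)) -> proper_tubing P T'.
Proof.
move=> [H1 _ H3 H4] sub H2; split.
- by move=> t /sub /H1.
- by move=> t T't k; exact: H2.
- by move=> s t /sub Ts /sub Tt; exact: H3.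
- by move=> m t tT' tlt; apply: H4 => // l lm; apply/sub/tT'.
Qed.

Lemma subset_card_eq s t : finite_set t -> s `<=` t ->
  (msize t <= msize s)%N -> s = t.
Proof.
move=> tf st ts; apply/seteqP; split=> // i ti; apply: contrapT => nsi.
by have := card_fset_proper tf st ti nsi; lia.
Qed.

Definition remove_class T t0 : set (set int) :=
  [set t | T t /\ forall k, t <> shift_tube n t0 k].

Lemma remove_class_tubing T t0 : proper_tubing P T -> proper_tubing P (remove_class T t0).
Proof.
move=> T_tub; apply: (sub_proper_tubing T_tub) => [t []//|t k [Tt nt]].
split; first exact/(tubing_shift T_tub).
move=> l tl; apply: (nt (l - k)); have := congr1 (fun s => shift_tube n s (- k)) tl.
by rewrite /= !shift_tubeD subrr shift_tube0.
Qed.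

(** As t0 has the largest size, no remaining tube contains it, so those meeting t0 lie inside it.
    The layout of t0 keeps differences within blocks, hence all that was achieved on them. *)
Lemma add_class_realize T t0 (u : int -> R^o) :
  proper_tubing P T -> T t0 -> (forall t, T t -> (msize t <= msize t0)%N) ->
  (forall i, u (i + N) = u i) ->
  (forall t, remove_class T t0 t -> realizes_on P (remove_class T t0) u t) ->
  exists2 v : int -> R^o, forall i, v (i + N) = v i &
    forall t, T t -> realizes_on P T v t.
Proof.
move=> T_tub Tt0 t0max u_per u_real; set T' := remove_class T t0 in u_real *.
have T'_tub : proper_tubing P T' by exact: remove_class_tubing.
have Tp t : T t -> proper_tube P t by exact: (tubing_proper T_tub).
have Tf t : T t -> finite_set t by move=> /Tp; exact: (proper_tube_finite n_gt0).
have t0p := Tp _ Tt0.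
have T'T t : T' t -> T t by case.
have T'_ne t : T' t -> ~ t0 `<=` t.
  move=> [Tt nt] t0t; apply: (nt 0); rewrite shift_tube0; apply/esym.
  by apply: subset_card_eq t0t (t0max _ Tt); exact: Tf.
have T'_sub t e : T' t -> t e -> t0 e -> t `<=` t0.
  move=> T't te t0e; have [//|t0t] := tubing_nested T_tub (T'T _ T't) Tt0 te t0e.
  by have := T'_ne _ T't.
have [y [y_blk ay y_gt]] := exists_layout n_gt0 T'_tub u_per u_real t0p T'_sub T'_ne.
have T_t0_sub s : T s -> s `<=` t0 -> s <> t0 -> T' s.
  move=> Ts st st0; split=> // k sk; apply: st0; apply: subset_card_eq st _; first exact: Tf.
  by rewrite sk msize_shift //; exact: Tf.
have y_real : realizes_on P T y t0.
  move=> s sp st; have [->|st0] := pselect (s = t0); first by split.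
  have [[t [T't sub_t]]|nt] := pselect (exists t, T' t /\ s `<=` t).
    rewrite (@alpha_seq_ext _ _ _ s y u); last first.
      by move=> a b sa sb; apply: y_blk; [exact: st|exact: st|right; exists t; split => //;
        exact: sub_t].
    have [H1 H2] := u_real _ T't _ sp sub_t; split=> [Ts|nTs]; first exact/H1/T_t0_sub.
    by apply: H2 => -[].
  split=> [Ts|_]; first by case: nt; exists s; split => //; exact: T_t0_sub.
  by apply: y_gt => // t T't sub_t; apply: nt; exists t.
pose inb i k := t0 (i + k * N).
have inb_uniq i k l : inb i k -> inb i l -> k = l.
  move=> ik il; have := @proper_tube_injk _ _ n_gt0 _ (i + k * N) (l - k) t0p ik.
  have -> : i + k * N + (l - k) * N = i + l * N by ring.
  by move=> /(_ il) /eqP; rewrite subr_eq0 => /eqP ->.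
(* The layout is copied to every translate of t0 and u is kept elsewhere; this is unambiguous
   because the translates are disjoint. *)
pose v i : R^o := if pselect (exists k, inb i k) is left e then y (i + sval (cid e) * N)
  else u i.
have v_in i k : inb i k -> v i = y (i + k * N).
  move=> ik; rewrite /v; case: pselect => [e|[]]; last by exists k.
  by rewrite (inb_uniq _ _ _ ik (svalP (cid e))).
have v_out i : (forall k, ~ inb i k) -> v i = u i.
  by move=> ni; rewrite /v; case: pselect => // -[k ik]; have := ni k ik.
have inbN i k : inb (i + N) k <-> inb i (k + 1).
  by rewrite /inb mulrDl mul1r [_ * N + N]addrC addrA.
exists v.
  move=> i; have [[k ik]|ni] := pselect (exists k, inb (i + N) k).
    rewrite (v_in _ _ ik) (v_in i (k + 1)); last exact/inbN.
    by congr y; ring.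
  rewrite !v_out ?u_per // => k ik; apply: ni; last by exists k.
  by exists (k - 1); apply/inbN; rewrite subrK.
have v_real0 k s : proper_tube P s -> s `<=` shift_tube n t0 k ->
    (T s -> alpha_seq P s v = bound s) /\ (~ T s -> bound s < alpha_seq P s v).
  move=> sp st; pose s' := shift_tube n s (- k).
  have sE : s = shift_tube n s' k by rewrite shift_tubeD addNr shift_tube0.
  have s't : s' `<=` t0.
    move=> i /shift_tubeP; rewrite mulNr opprK => /st /shift_tubeP.
    by rewrite addrK.
  have sa : alpha_seq P s v = alpha_seq P s' y.
    rewrite {1}sE alpha_seq_shift; apply: alpha_seq_ext => a b s'a s'b.
    have E i : s' i -> v (i + k * N) = y i.
      move=> s'i; rewrite (v_in _ (- k)); first by congr y; ring.
      by rewrite /inb mulNr addrK; exact: s't.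
    by rewrite !E.
  have := y_real s' (proper_tube_shift n_gt0 (- k) sp) s't.
  have sf := proper_tube_finite n_gt0 sp.
  rewrite -sa msize_shift // => -[H1 H2].
  split=> [Ts|nTs]; first by apply: H1; apply/(tubing_shift T_tub).
  by apply: H2 => /(tubing_shift T_tub).
move=> t Tt s sp st; have [[k tk]|nk] := pselect (exists k, t = shift_tube n t0 k).
  by apply: (v_real0 k) => //; rewrite -tk.
have T't : T' t by split => // k tk; apply: nk; exists k.
have [[i [k [ti ik]]]|ni] := pselect (exists i k, t i /\ inb i k).
  apply: (v_real0 (- k)) => //; apply: (subset_trans st) => j tj.
  apply/shift_tubeP; rewrite mulNr opprK.
  have T'tk : T' (shift_tube n t k) by case: T'_tub => _ H _ _; exact: H.
  by apply: (T'_sub _ (i + k * N) T'tk) => //; [exists i|exists j].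
rewrite (@alpha_seq_ext _ _ _ s v u); last first.
  move=> a b sa sb; rewrite !v_out // => k ik; apply: ni.
    by exists a, k; split => //; exact: st.
  by exists b, k; split => //; exact: st.
have [H1 H2] := u_real _ T't _ sp st; split=> [Ts|nTs]; last by apply: H2 => -[].
apply: H1; split=> // k sk; have := T'_ne (shift_tube n t (- k)); apply.
  by case: T'_tub => _ H _ _; exact: H.
move=> i t0i; apply/shift_tubeP; rewrite mulNr opprK; apply: st; rewrite sk.
by exists i.
Qed.

(* A set of representatives of the tubes modulo translation. *)
Definition tube_window : set (set int) :=
  [set t | proper_tube P t /\ exists2 i, t i & 0 <= i < N /\ forall j, t j -> i <= j].

(** If i and r + kn lie in a proper tube, k is bounded on both sides: by cofinality, a k too large
    would put r + kn above i + n, and convexity would place i + n in the tube; symmetrically for k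
    too small. All tubes of the window therefore lie in one finite interval. *)
Lemma tube_window_finite : finite_set tube_window.
Proof.
have bnd (i r : 'I_n) : exists B : int, forall t, proper_tube P t -> t (i : nat)%:Z ->
    forall k, t ((r : nat)%:Z + k * N) -> - B <= k <= B.
  have [a ia] := ale_cofinal P ((i : nat)%:Z + N) (r : nat)%:Z.
  have [b rb] := ale_cofinal P (r : nat)%:Z (i : nat)%:Z.
  exists (`|a| + `|b| + 2) => t tp ti k tk; have [[_ tv _ _] _] := tp.
  have no_up x l : t x -> t (x + l) -> ~~ ale P (x + N) (x + l).
    move=> tx tl; apply/negP => H; have tN : t (x + 1 * N).
      apply: tv tx tl _ _; first by apply: ale_up.
      by rewrite mul1r.
    by have := proper_tube_injk n_gt0 tp tx tN.
  have ka : k < a.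
    rewrite ltNge; apply/negP => ak.
    have := no_up (i : nat)%:Z ((r : nat)%:Z + k * N - (i : nat)%:Z) ti;
      rewrite addrC subrK => /(_ tk) /negP; apply.
    apply: ale_trans ia _; have := @ale_up n P ((r : nat)%:Z + a * N) (k - a).
    have -> : (r : nat)%:Z + a * N + (k - a) * N = (r : nat)%:Z + k * N by ring.
    by apply; lia.
  have kb : - b - 1 < k.
    rewrite ltNge; apply/negP => kb'.
    have := no_up ((r : nat)%:Z + k * N) ((i : nat)%:Z - ((r : nat)%:Z + k * N)) tk;
      rewrite [_ + (_ - _)]addrC subrK => /(_ ti) /negP; apply.
    have := rb; rewrite -(ale_shiftk P (- b)) -addrA -mulrDl subrr mul0r addr0.
    apply: ale_trans; have := @ale_up n P ((r : nat)%:Z + k * N + N) (- b - 1 - k).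
    rewrite (_ : _ + (- b - 1 - k) * N = (r : nat)%:Z + (- b) * N); last by ring.
    by apply; lia.
  by lia.
pose B (i r : 'I_n) := sval (cid (bnd i r)).
have BP (i r : 'I_n) : forall t, proper_tube P t -> t (i : nat)%:Z ->
    forall k, t ((r : nat)%:Z + k * N) -> - B i r <= k <= B i r by exact: svalP (cid (bnd i r)).
pose C : nat := (\sum_(i < n) \sum_(r < n) `|B i r|)%N.
pose W : set int := [set x | - (C%:Z + 1) * N <= x <= (C%:Z + 1) * N].
have Wf : finite_set W.
  pose f (k : nat) : int := k%:Z - (C%:Z + 1) * N.
  apply: (@sub_finite_set _ _ (f @` `I_(2 * (C + 1) * n).+1));
    last exact/finite_image/finite_II.
  move=> x /andP[x1 x2]; exists `|(x + (C%:Z + 1) * N)%R|%N; rewrite /f /=; last by lia.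
  nia.
have sub : tube_window `<=` [set t | t `<=` W].
  move=> t [tp [i ti [/andP[i0 iN] _]]] x tx.
  have ri : (`|i| < n)%N by lia.
  have rx : (`|(x %% N)%Z| < n)%N.
    have : 0 <= (x %% N)%Z by apply: modz_ge0; lia.
    have : (x %% N)%Z < N by apply: ltz_pmod; lia.
    lia.
  have xr0 : 0 <= (x %% N)%Z by apply: modz_ge0; lia.
  have xrN : (x %% N)%Z < N by apply: ltz_pmod; lia.
  have := BP (Ordinal ri) (Ordinal rx) t tp;
    rewrite /= gez0_abs // gez0_abs // => /(_ ti (x %/ N)%Z).
  rewrite addrC -divz_eq => /(_ tx) /andP[k1 k2].
  have BC : (`|B (Ordinal ri) (Ordinal rx)| <= C)%N.
    rewrite /C (bigD1 (Ordinal ri)) //= (bigD1 (Ordinal rx)) //= -addnA leq_addr //.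
  have kC : - C%:Z <= (x %/ N)%Z <= C%:Z by lia.
  have xE := divz_eq x N; rewrite /W /=; move: xr0 xrN kC xE n_gt0.
  move: (x %/ N)%Z (x %% N)%Z => d e; clear => e0 eN /andP[d1 d2] -> n0.
  apply/andP; split; nia.
apply: sub_finite_set sub _.
have : finite_set [set` fpowerset (fset_set W)] by exact: finite_fset.
move=> /(finite_image (fun X : {fset int} => [set` X])); apply: sub_finite_set => t tW.
have tf : finite_set t by exact: sub_finite_set tW Wf.
exists (fset_set t); last by rewrite fset_setK.
rewrite /= fpowersetE; apply/fsubsetP => x; rewrite !in_fset_set // !inE; exact: tW.
Qed.

Lemma window_rep t : proper_tube P t -> exists k, tube_window (shift_tube n t k).
Proof.
move=> tp; have [a ta] := proper_tube_neq0 n_gt0 tp.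
have [m tm mmin] := @finite_argmax R t (fun i => - i%:~R) a (proper_tube_finite n_gt0 tp) ta.
exists (- (m %/ N)%Z); split; first exact: proper_tube_shift.
exists (m + - (m %/ N)%Z * N); first by exists m.
have mE := divz_eq m N.
have : 0 <= (m %% N)%Z by apply: modz_ge0; lia.
have : (m %% N)%Z < N by apply: ltz_pmod; lia.
split; first by rewrite mulNr; apply/andP; split; lia.
move=> _ [j tj <-]; rewrite lerD2r; have := mmin _ tj; rewrite lerN2 ler_int //.
Qed.

Lemma window_uniq t k : tube_window t -> tube_window (shift_tube n t k) -> k = 0.
Proof.
move=> [_ [i ti [/andP[i0 iN] imin]]] [_ [j [j' tj' <-] [/andP[j0 jN] jmin]]].
have := imin _ tj'; have := jmin (i + k * N) (ex_intro2 _ _ i ti erefl).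
nia.
Qed.

(** The class of a largest tube is removed and put back last. The sequence is strictly periodic
    because only differences inside tubes matter here; [realize_final] supplies the increment c. *)
Lemma exists_periodic_realization T : proper_tubing P T ->
  exists2 u : int -> R^o, forall i, u (i + N) = u i &
    forall t, T t -> realizes_on P T u t.
Proof.
move=> T_tub.
have [k] := ubnP #|` fset_set (T `&` tube_window)|.
elim: k T T_tub => // k IH T T_tub Tk.
have TWf S : finite_set (S `&` tube_window) by apply: sub_finite_set tube_window_finite;
  move=> t [].
have [[t1 Tt1]|nT] := pselect (exists t, T t); last first.
  by exists (fun=> 0) => // t Tt; case: nT; exists t.
have [t0 Tt0 t0max] : exists2 t0, T t0 & forall t, T t -> (msize t <= msize t0)%N.
  have exm : exists m, `[< exists2 t, T t & (n - msize t)%N = m >].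
    by exists (n - msize t1)%N; apply/asboolP; exists t1.
  case: (ex_minnP exm) => m /asboolP[t0 Tt0 tm] mmin; exists t0 => // t Tt.
  have := mmin (n - msize t)%N (asboolT (ex_intro2 _ _ t Tt erefl)).
  have /andP[_ tn] := proper_tube_size n_gt0 (tubing_proper T_tub Tt).
  have /andP[_ t0n] := proper_tube_size n_gt0 (tubing_proper T_tub Tt0).
  lia.
have [|u u_per u_real] := IH _ (remove_class_tubing t0 T_tub).
  rewrite ltnS in Tk; apply: leq_trans _ Tk.
  have [l wl] := window_rep (tubing_proper T_tub Tt0).
  have lT : shift_tube n t0 l \in fset_set (T `&` tube_window).
    by rewrite in_fset_set // inE; split => //; apply/(tubing_shift T_tub).
  rewrite (cardfsD1 (shift_tube n t0 l) (fset_set (T `&` tube_window))) lT add1n ltnS.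
  apply: fsubset_leq_card; apply/fsubsetP => t.
  rewrite in_fsetD1 !in_fset_set // !inE => -[[Tt nt] tw]; apply/andP; split;
    last exact/mem_set.
  exact/eqP.
exact: add_class_realize T_tub Tt0 t0max u_per u_real.
Qed.

Lemma exists_realization T : proper_tubing P T ->
  exists2 x : int -> R^o, period_seq n x &
    forall s, proper_tube P s ->
      (T s -> alpha_seq P s x = bound s) /\ (~ T s -> bound s < alpha_seq P s x).
Proof.
move=> T_tub; have [u u_per u_real] := exists_periodic_realization T_tub.
have [x xp xr] := realize_final n_gt0 T_tub u_per u_real.
by exists x.
Qed.

End Existence.

Lemma exists_scalar_map (R : realType) (V : lmodType R) (g : V -> R) :
  scalar g -> exists f : {scalar V}, forall x, f x = g x.
Proof.
move=> g_lin; pose h := GRing.isLinear.Build R V R _ g g_lin.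
by exists (HB.pack_for {scalar V} g h).
Qed.

(** * The realization *)

Section Realization.
Variables (R : realType) (n : nat) (P : affinePoset n).
Hypothesis n_gt0 : (0 < n)%N.
Local Notation N := (n%:Z).
Local Notation msize t := #|` fset_set t|.
Local Notation bound t := ((n ^ (2 * msize t))%:R : R).
Local Notation c := ((n ^ (2 * n.+1))%:R : R).
Local Notation Q := (cyclohedron_realization R P).
Local Notation pi := (\pi_(seqmod R)).
Implicit Types (x : int -> R^o) (t : set int) (y : 'rV[R]_n.-1).

(** The class of n - 1 is left out: modulo constants, its indicator is minus the sum of the
    others. *)
Definition residue_seq (i : 'I_n.-1) : int -> R^o :=
  fun j => ((j %% N)%Z == (i : nat)%:Z)%:R.

Definition base_seq : int -> R^o := fun j => (j %/ N)%Z%:~R * c.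

Definition comb_seq y : int -> R^o := fun j => \sum_i y 0 i * residue_seq i j.

Lemma comb_pi y : comb (fun i => pi (residue_seq i)) y = pi (comb_seq y).
Proof.
have sum_pi (s : seq 'I_n.-1) : \sum_(i <- s) y 0 i *: (pi (residue_seq i) : seqmod R) =
    pi ((fun j => \sum_(i <- s) y 0 i * residue_seq i j) : int -> R^o).
  elim: s => [|i s IH].
    rewrite big_nil; have -> : (fun j =>
      \sum_(i <- [::]) y 0 i * residue_seq i j) = 0 :> (int -> R^o).
      by apply/funext => j; rewrite big_nil.
    by rewrite raddf0.
  rewrite big_cons IH -pi_seqmod_linear; congr (pi _); apply/funext => j.
  by rewrite big_cons.
exact: sum_pi.
Qed.

Lemma comb_seq_val y (i : 'I_n.-1) : comb_seq y (i : nat)%:Z = y 0 i.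
Proof.
have iN : ((i : nat)%:Z %% N)%Z = (i : nat)%:Z.
  by rewrite modz_small //; have := ltn_ord i; lia.
rewrite /comb_seq (bigD1 i) //= big1 ?addr0.
  by rewrite /residue_seq iN eqxx mulr1.
move=> j ji; rewrite /residue_seq iN eqz_nat.
by rewrite (_ : (_ == _ :> nat) = false) ?mulr0 //; apply: contraNF ji => /eqP/val_inj ->.
Qed.

Lemma comb_seq_last y : comb_seq y n.-1%:Z = 0.
Proof.
rewrite /comb_seq big1 // => i _; rewrite /residue_seq modz_small; last by lia.
rewrite eqz_nat (_ : (_ == _ :> nat) = false) ?mulr0 //.
by have := ltn_ord i; apply: contraTF => /eqP <-; rewrite ltnn.
Qed.

Lemma comb_seq_per y j : comb_seq y (j + N) = comb_seq y j.
Proof. by apply: eq_bigr => i _; rewrite /residue_seq modzDr. Qed.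

Lemma base_seq_per : period_seq n base_seq.
Proof.
move=> j; have N0 : N != 0 by lia.
by rewrite /base_seq divzDr ?dvdzz // divzz N0 intrD mulrDl; congr (_ + _); exact: mul1r.
Qed.

Lemma comb_residue_inj y : comb (fun i => pi (residue_seq i)) y = 0 -> y = 0.
Proof.
rewrite comb_pi -(raddf0 pi) => /seqmod_eqP [a ya].
have a0 : a = 0 by have := ya n.-1%:Z; rewrite comb_seq_last add0r.
by apply/rowP => i; rewrite mxE -comb_seq_val ya a0 addr0.
Qed.

Lemma period_seqmodP (p : seqmod R) : period_seqmod n p <->
  exists y, p = pi base_seq + comb (fun i => pi (residue_seq i)) y.
Proof.
split=> [[x xp <-]|[y ->]].
  (* Coordinates of the representative normalized to vanish at n - 1. *)
  exists (\row_i (x (i : nat)%:Z - x n.-1%:Z)); rewrite comb_pi -raddfD.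
  apply/seqmod_eqP; exists (x n.-1%:Z) => j.
  have jE := divz_eq j N.
  have r0 : 0 <= (j %% N)%Z by apply: modz_ge0; lia.
  have rN : (j %% N)%Z < N by apply: ltz_pmod; lia.
  have xE : x j = x (j %% N)%Z + (j %/ N)%Z%:~R * c.
    by rewrite {1}jE addrC (period_shiftk xp).
  set y := \row_i _.
  have cE : comb_seq y j = x (j %% N)%Z - x n.-1%:Z.
    have -> : comb_seq y j = comb_seq y (j %% N)%Z.
      by apply: eq_bigr => i _; rewrite /residue_seq modz_mod.
    have [rl|rl] := ltnP `|(j %% N)%Z| n.-1.
      have -> : (j %% N)%Z = (Ordinal rl : nat)%:Z by rewrite /= gez0_abs.
      by rewrite comb_seq_val mxE.
    have -> : (j %% N)%Z = n.-1%:Z by lia.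
    by rewrite comb_seq_last subrr.
  rewrite xE; transitivity (base_seq j + comb_seq y j + x n.-1%:Z) => //.
  by rewrite cE /base_seq; ring.
rewrite comb_pi -raddfD; exists (base_seq + comb_seq y) => // j.
transitivity (base_seq (j + N) + comb_seq y (j + N)) => //.
rewrite base_seq_per comb_seq_per.
by transitivity (base_seq j + c + comb_seq y j) => //; rewrite addrAC.
Qed.

Definition feasible x := period_seq n x /\
  forall t, proper_tube P t -> bound t <= alpha_seq P t x.

Lemma realizationP (p : seqmod R) : Q p <-> exists2 x, p = pi x & feasible x.
Proof.
split=> [[[x xp <-] H]|[x -> [xp H]]].
  by exists x => //; split => // t tp; have [_] := H t tp; rewrite /= alpha_pi.
split; first by exists x.
by move=> t tp; split; [exists x|rewrite /= alpha_pi; exact: H].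
Qed.

Lemma alpha_shift x t k : period_seq n x ->
  alpha_seq P (shift_tube n t k) x = alpha_seq P t x.
Proof.
move=> xp; rewrite alpha_seq_shift; apply: alpha_seq_ext => a b _ _.
by rewrite !(period_shiftk xp); ring.
Qed.

(** Cofinality gives i below some j + kn, so monotonicity on the ray bounds s (d i - d j)
    independently of s. By symmetry d is constant, hence zero in the quotient. *)
Lemma feasible_bounded x (d : int -> R^o) : period_seq n x -> (forall i, d (i + N) = d i) ->
  (forall s : R, 0 <= s -> feasible (fun i => x i + s * d i)) -> forall i j, d i <= d j.
Proof.
move=> xp dp H i j; have [k ik] := ale_cofinal P i j; rewrite leNgt; apply/negP => dij.
have H1 (s : R) : 0 <= s -> x i + s * d i <= x j + k%:~R * c + s * d j.
  move=> s0; have [sp sf] := H _ s0; have := ale_mono n_gt0 sp sf ik.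
  by rewrite (period_shiftk sp) /= addrAC.
pose D : R := d i - d j.
have D0 : 0 < D by rewrite /D subr_gt0.
pose s : R := (`|x j + k%:~R * c - x i| + 1) / D.
have s0 : 0 <= s by rewrite divr_ge0 ?ltW.
have sD : s * D = `|x j + k%:~R * c - x i| + 1 by rewrite divfK // gt_eqF.
have := H1 _ s0; have := ler_norm (x j + k%:~R * c - x i); move: sD; rewrite /D mulrBr.
clear; lra.
Qed.

(** One index for each translation class: translates have the same alpha on periodic sequences, so
    with repetitions not every subset of a tight set could itself be tight. *)
Let I : finType := fset_set (tube_window P).

Lemma index_window (k : I) : tube_window P (val k).
Proof.
by have := valP k; rewrite in_fset_set ?inE //; exact: tube_window_finite.
Qed.

Lemma index_proper (k : I) : proper_tube P (val k).
Proof. by case: (index_window k). Qed.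

Lemma index_rep t : proper_tube P t -> exists (k : I) l, val k = shift_tube n t l.
Proof.
move=> tp; have [l wl] := window_rep R n_gt0 tp.
have lI : shift_tube n t l \in fset_set (tube_window P).
  by rewrite in_fset_set ?inE //; exact: tube_window_finite.
by exists [` lI]%fset, l.
Qed.

Lemma alpha_scalar (k : I) : scalar (alpha P (val k) : seqmod R -> R).
Proof.
move=> a p q; have [x ->] := pi_seqmod_surj p; have [y ->] := pi_seqmod_surj q.
rewrite -pi_seqmod_linear !alpha_pi -alpha_seq_lin //.
exact: (proper_tube_finite n_gt0 (index_proper k)).
Qed.

Definition facet_functional (k : I) : {scalar seqmod R} :=
  sval (cid (exists_scalar_map (@alpha_scalar k))).

Lemma facet_functionalE k p : facet_functional k p = alpha P (val k) p.
Proof. exact: (svalP (cid (exists_scalar_map (@alpha_scalar k)))). Qed.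

Let e (i : 'I_n.-1) : seqmod R := pi (residue_seq i).
Let b (k : I) : R := bound (val k).
Local Notation poly := (polyhedron (pi base_seq) e facet_functional b).
Local Notation act := (act facet_functional b).

Lemma realization_polyhedron : Q = poly.
Proof.
apply/seteqP; split=> p.
  move=> /realizationP[x pE [xp xf]]; split.
    by apply/period_seqmodP; exists x.
  by move=> k; rewrite facet_functionalE pE alpha_pi; apply: xf; exact: index_proper.
move=> [/period_seqmodP[x xp <-] H]; apply/realizationP; exists x => //; split=> // t tp.
have [k [l kE]] := index_rep tp; have := H k.
rewrite facet_functionalE alpha_pi /b kE alpha_shift // msize_shift //.
exact: (proper_tube_finite n_gt0 tp).
Qed.

Lemma mem_act x (k : I) : (k \in act (pi x)) <-> active P x (val k).
Proof.
rewrite inE facet_functionalE alpha_pi; split=> [/eqP H|[_ ->]//].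
by split => //; exact: index_proper.
Qed.

Lemma active_rep x t (k : I) l : feasible x -> val k = shift_tube n t l -> proper_tube P t ->
  active P x (val k) <-> active P x t.
Proof.
move=> [xp xf] kE tp; rewrite kE; split; last exact: active_shift.
move=> /(active_shift n_gt0 xp (- l)); by rewrite shift_tubeD subrr shift_tube0.
Qed.

Lemma act_sub x x' : feasible x -> feasible x' ->
  act (pi x) \subset act (pi x') <-> active P x `<=` active P x'.
Proof.
move=> xf xf'; split=> [/fintype.subsetP H t tA|H].
  have tp := proj1 tA; have [k [l kE]] := index_rep tp.
  by apply/(active_rep xf' kE tp)/(mem_act x' _)/H/(mem_act x _)/(active_rep xf kE tp).
by apply/fintype.subsetP => k /(mem_act x _)/H/(mem_act x' _).
Qed.

Lemma feasible_tubing x : feasible x -> proper_tubing P (active P x).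
Proof. by move=> [xp xf]; exact: active_proper_tubing. Qed.

Lemma tubing_feasible T : proper_tubing P T -> exists2 x, feasible x & active P x = T.
Proof.
move=> T_tub; have [x xp xT] := exists_realization R n_gt0 T_tub; exists x.
  split=> // t tp; have [H1 H2] := xT t tp.
  by have [/H1 ->|/H2/ltW] := pselect (T t).
apply/seteqP; split=> t; last first.
  move=> Tt; have tp : proper_tube P t by case: T_tub => H _ _ _; exact: H.
  by split => //; apply: (xT t tp).1.
move=> [tp tE]; apply: contrapT => nT; have := (xT t tp).2 nT.
by rewrite tE ltxx.
Qed.

Lemma poly_feasible p : poly p -> exists2 x, p = pi x & feasible x.
Proof. by rewrite -realization_polyhedron => /realizationP. Qed.

Lemma feasible_poly x : feasible x -> poly (pi x).
Proof. by move=> xf; rewrite -realization_polyhedron; apply/realizationP; exists x. Qed.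

Lemma realization_bounded p y : poly p -> comb e y != 0 ->
  exists2 s : R, 0 <= s & ~ poly (p + s *: comb e y).
Proof.
move=> /poly_feasible[x -> [xp _]] y0; apply: contrapT => H; move/eqP: y0; apply.
have cst : forall i j, comb_seq y i <= comb_seq y j.
  apply: (feasible_bounded xp (comb_seq_per y)) => s s0.
  have : poly (pi x + s *: comb e y) by apply: contrapT => np; apply: H; exists s.
  rewrite comb_pi addrC -pi_seqmod_linear => /poly_feasible[x' /seqmod_eqP[a xa] [x'p x'f]].
  have E i : x i + s * comb_seq y i = x' i + a.
    by rewrite -xa; transitivity (s * comb_seq y i + x i); [rewrite addrC|].
  split=> [i|t tp]; first by rewrite !E x'p; rewrite addrAC.
  rewrite (@alpha_seq_ext _ _ _ _ _ x') ?x'f // => i j _ _.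
  by rewrite !E; ring.
rewrite comb_pi -(raddf0 pi); apply/seqmod_eqP; exists (comb_seq y 0) => i.
transitivity (comb_seq y 0); last by rewrite -[LHS]add0r.
by apply/eqP; rewrite eq_le !cst.
Qed.

Lemma poly_nonempty : exists p, poly p.
Proof.
have [|x xf _] := @tubing_feasible set0; last by exists (pi x); exact: feasible_poly.
by split=> // m t /(_ 0%N (leq0n _)).
Qed.

(** The translates of the tubes in S form a subset of a tubing that is closed under translation. A
    point realizing it has tight set exactly S, as the window meets each class only once. *)
Lemma realization_act_down p (S : {set I}) : poly p -> S \subset act p ->
  exists2 q, poly q & act q = S.
Proof.
move=> /poly_feasible[x -> xf] /fintype.subsetP Sx.
pose T := [set t | exists2 k : I, k \in S & exists l, val k = shift_tube n t l].
have T_tub : proper_tubing P T.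
  apply: (sub_proper_tubing (feasible_tubing xf)).
    move=> t [k kS [l kE]]; have kA := (mem_act x k).1 (Sx _ kS).
    have tE : t = shift_tube n (val k) (- l) by rewrite kE shift_tubeD subrr shift_tube0.
    by rewrite tE; case: xf => xp _; exact: active_shift.
  move=> t m [k kS [l kE]]; exists k => //; exists (l - m).
  by rewrite shift_tubeD addrC subrK.
have [x' xf' xT] := tubing_feasible T_tub; exists (pi x'); first exact: feasible_poly.
apply/setP => k; apply/idP/idP.
  move=> /(mem_act x' k); rewrite xT => -[k' k'S [l kE]].
  have wk' := index_window k'; rewrite kE in wk'.
  have l0 := window_uniq n_gt0 (index_window k) wk'.
  by rewrite l0 shift_tube0 in kE; rewrite -(val_inj kE).
move=> kS; apply/(mem_act x' k); rewrite xT; exists k => //.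
by exists 0; rewrite shift_tube0.
Qed.

Definition face_tubing (F : set (seqmod R)) : set (set int) :=
  [set t | proper_tube P t /\ forall p, F p -> alpha P t p = bound t].

Lemma face_tubing_flat x : feasible x ->
  face_tubing (flat (pi base_seq) e facet_functional b (act (pi x))) = active P x.
Proof.
move=> xf; apply/seteqP; split=> t.
  move=> [tp H]; split => //; have := H (pi x); rewrite alpha_pi; apply; split => //.
  exact: feasible_poly.
move=> tA; have tp := proj1 tA; split => // p [/poly_feasible[x' -> xf'] sub].
have tA' := (act_sub xf xf').1 sub _ tA.
by rewrite alpha_pi; case: tA'.
Qed.

Lemma realization_faces (F : set (seqmod R)) : face Q F <->
  exists2 x, feasible x & F = flat (pi base_seq) e facet_functional b (act (pi x)).
Proof.
rewrite realization_polyhedron; split.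
  move=> /(faceP) [p Fp [/poly_feasible[x pE xf] FE]].
  by exists x => //; rewrite -pE.
by move=> [x /feasible_poly xp ->]; exact: face_flat.
Qed.

End Realization.

Theorem theorem2p8 (R : realType) (n : nat) (n_gt0 : (0 < n)%N)
    (P : affinePoset n) :
  let Q : set (seqmod R) := cyclohedron_realization R P in
  simple_polytope Q n.-1 /\
  exists phi : set (seqmod R) -> set (set int),
    [/\ set_bij (face Q) (proper_tubing P) phi,
        forall F G, face Q F -> face Q G ->
          (F `<=` G <-> phi G `<=` phi F) &
        forall F, face Q F ->
          ((exists v, F = [set v]) <-> maximal_tubing P (phi F))].
Proof.
move=> Q; split.
  rewrite /Q (realization_polyhedron R P n_gt0).
  apply: polyhedron_simple.
  - exact: comb_residue_inj.
  - exact: realization_bounded.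
  - exact: poly_nonempty.
  - exact: realization_act_down.
(* Proved first because it also yields injectivity: faces with equal tubings contain each other. *)
have order F G : face Q F -> face Q G ->
    (F `<=` G <-> face_tubing P G `<=` face_tubing P F).
  move=> /(realization_faces P n_gt0)[x xf ->] /(realization_faces P n_gt0)[x' xf' ->].
  rewrite !face_tubing_flat // flat_mono;
    [exact: act_sub|exact: feasible_poly|exact: feasible_poly].
exists (face_tubing P); split => //.
  split.
  - move=> F /(realization_faces P n_gt0)[x xf ->]; rewrite face_tubing_flat //.
    exact: feasible_tubing.
  - move=> F G /set_mem FF /set_mem FG FGE; apply/seteqP; split.
      by apply/order => //; rewrite FGE.
    by apply/order => //; rewrite FGE.
  - move=> T /(tubing_feasible R n_gt0)[x xf <-].
    eexists; last exact: (face_tubing_flat n_gt0 xf).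
    by apply/realization_faces; exists x.
move=> F /(realization_faces P n_gt0)[x xf ->]; rewrite face_tubing_flat //.
rewrite flat_set1; last 2 first.
- exact: realization_bounded.
- exact: feasible_poly.
split=> [H|[_ H] q /poly_feasible[x' -> xf'] sub].
  split; first exact: feasible_tubing.
  move=> T /(tubing_feasible R n_gt0)[x' xf' <-] sub; apply/seteqP; split => //.
  apply/(act_sub n_gt0 xf' xf); rewrite (H (\pi_(seqmod R) x')) //; first exact: feasible_poly.
  exact/(act_sub n_gt0 xf xf').
have E := H _ (feasible_tubing n_gt0 xf') ((act_sub n_gt0 xf xf').1 sub).
apply/eqP; rewrite finset.eqEsubset sub andbT.
by apply/(act_sub n_gt0 xf' xf); rewrite E.
Qed.
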